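(* Let $(M,\Phi)$ be a toric $\mathrm{Spin}(7)$-manifold, with $M_0$, $\theta$, $\nu$ and $V$ as defined in the context. On $M_0$, the $4$-form $\Phi$ is $$\Phi=\det(V)\sum_{(ijk\ell)}(-1)^i\theta_i\wedge d\nu_{jk\ell}+\sum_{(ijk\ell)}(-1)^\ell\theta_{ijk}\wedge d\nu_\ell+\frac{1}{2\det(V)}\bigl(d\nu^t\operatorname{adj}(V)\theta\bigr)^2.$$ The associated $\mathrm{Spin}(7)$-metric is given by $$g=\frac1{\det(V)}\theta^t\operatorname{adj}(V)\theta+d\nu^t\operatorname{adj}(V)d\nu.$$
   Context: **$\mathrm{Spin}(7)$-structures.** On $\mathbb R^8$ with basis $E_0,\dots,E_7$ and dual basis $e^0,\dots,e^7$ (writing $e^{ab}=e^a\wedge e^b$ etc., wedge signs suppressed), let $\varphi_0=e^{123}-e^1(e^{45}+e^{67})-e^2(e^{46}+e^{75})-e^3(e^{47}+e^{56})$ and $\Phi_0=e^0\wedge\varphi_0+{*}_{\varphi_0}\varphi_0$, where ${*}_{\varphi_0}$ is the Hodge star on $\langle E_1,\dots,E_7\rangle$ for the metric $\sum_{j=1}^7(e^j)^2$ and orientation $e^{1234567}$. The stabiliser of $\Phi_0$ in $\mathrm{GL}(8,\mathbb R)$ is $\mathrm{Spin}(7)\subset\mathrm{SO}(8)$, and $\Phi_0$ determines the metric $g_0=\sum_{j=0}^7(e^j)^2$ and volume form $e^{01234567}$. A $\mathrm{Spin}(7)$-structure on an $8$-manifold $M$ is a $4$-form $\Phi$ pointwise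 linearly equivalent to $\Phi_0$; it determines a Riemannian metric $g$ and a volume form on $M$. It is torsion-free if $\Phi$ is parallel for the Levi-Civita connection of $g$, equivalently $d\Phi=0$. **Toric $\mathrm{Spin}(7)$-manifolds.** Let a four-torus $T^4$ act on $M$ preserving $\Phi$, and let $\xi:\mathfrak t^4\to\mathfrak X(M)$ be the infinitesimal action. If $\Phi$ is closed, a multi-moment map is a $T^4$-invariant map $\nu:M\to\Lambda^3(\mathfrak t^4)^*$ with $d\langle\nu,W\rangle=\xi(W)\lrcorner\Phi$ for all $W\in\Lambda^3\mathfrak t^4$, where $\xi(W)$ is the multivector field determined by $W$ via $\xi$. The action is multi-Hamiltonian if such a map exists. A toric $\mathrm{Spin}(7)$-manifold is a connected $8$-manifold $M$ with a torsion-free $\mathrm{Spin}(7)$-structure $\Phi$ and an effective multi-Hamiltonian action of $T^4$. **Data on $M_0$.** $M_0$ denotes the open dense union of principal orbits (points with trivial stabiliser). Let $U_0,\dots,U_3$ be infinitesimal generators for the $T^4$-action (images under $\xi$ of a basis of $\mathfrak t^4$). On $M_0$ let $\theta=(\theta_0,\dots,\theta_3)^t$ be the one-forms with $\theta_i(U_j)=\delta_{ij}$ and $\theta_i(X)=0$ for all $X\perp U_0,\dots,U_3$. Let $\nu=(\nu_0,\dots,\nu_3)^t$ be the components of the multi-moment map, so $d\nu_i=(-1)^i\,U_j\wedge U_k\wedge U_\ell\lrcorner\Phi=(-1)^i\Phi(U_j,U_k,U_\ell,\cdot)$ for $(ijk\ell)$ a cyclic permutation of $(0123)$. Put $B_{ij}=g(U_i,U_j)$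 and $V=B^{-1}$. **Notation.** $\theta_{ab}=\theta_a\wedge\theta_b$, $d\nu_{ab}=d\nu_a\wedge d\nu_b$, and similarly for more indices. $\sum_{(ijk\ell)}$ is the sum over the four cyclic permutations $(ijk\ell)$ of $(0123)$. $\operatorname{adj}(V)$ is the adjugate matrix, $d\nu^t\operatorname{adj}(V)\theta=\sum_{i,j}\operatorname{adj}(V)_{ij}\,d\nu_i\wedge\theta_j$, and its square is the wedge square. In the metric formula products of one-forms are symmetric products. *)

(* Defs.v *)
From HB Require Import structures.
From mathcomp Require Import all_boot all_order all_algebra all_fingroup.
From mathcomp Require Import all_classical all_reals all_analysis.

Set Implicit Arguments.
Unset Strict Implicit.
Unset Printing Implicit Defensive.

Import Order.TTheory GRing.Theory Num.Theory.
Import numFieldNormedType.Exports.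

Local Open Scope classical_set_scope.
Local Open Scope ring_scope.

(* A k-form on E is a function of k vectors; being multilinear and alternating
   is a separate predicate.  One-forms are plain functions E -> R. *)
Notation kform R E k := (('I_k -> E) -> R).

Definition alternating_form (R : realType) (E : lmodType R) (k : nat)
    (a : kform R E k) : Prop :=
  (forall (v : 'I_k -> E) (i : 'I_k), scalar (fun x => a [eta v with i |-> x]))
  /\ (forall (v : 'I_k -> E) (i j : 'I_k), i != j -> v i = v j -> a v = 0).

(* Normalisation: (a /\ b)(x, y) = a x * b y - a y * b x for one-forms, so that
   e^{1...k} takes the value 1 on (E_1, ..., E_k); [wedge_list a] =
   a_1 /\ ... /\ a_k for one-forms agrees with iterating [wedge_form]. *)
Definition wedge_form (R : realType) (E : lmodType R) (k l : nat)
    (a : kform R E k) (b : kform R E l) : kform R E (k + l) :=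
  fun v => (k`! * l`!)%:R^-1 *
    \sum_(s : 'S_(k + l)) (-1) ^+ s * a (fun i => v (s (lshift l i)))
                                    * b (fun j => v (s (rshift k j))).

Definition wedge_list (R : realType) (E : lmodType R) (k : nat)
    (a : k.-tuple (E -> R)) : kform R E k :=
  fun v => \det (\matrix_(i < k, j < k) tnth a i (v j)).

Definition sym_prod (R : realType) (E : lmodType R) (a b : E -> R) : E -> E -> R :=
  fun x y => 2^-1 * (a x * b y + a y * b x).

Definition coordf (R : realType) (a : nat) : 'rV[R]_8 -> R :=
  fun v => v 0 (inord a).

(* e^{ab...}; the indices are numbers in {0, ..., 7} *)
Definition emono (R : realType) (k : nat) (s : k.-tuple nat) :
    kform R 'rV[R]_8 k :=
  wedge_list (map_tuple (@coordf R) s).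

Definition phi0 (R : realType) : kform R 'rV[R]_8 3 :=
  fun v =>
    emono [tuple 1; 2; 3]%N v
    - wedge_form (emono [tuple 1]%N) (emono [tuple 4; 5]%N \+ emono [tuple 6; 7]%N) v
    - wedge_form (emono [tuple 2]%N) (emono [tuple 4; 6]%N \+ emono [tuple 7; 5]%N) v
    - wedge_form (emono [tuple 3]%N) (emono [tuple 4; 7]%N \+ emono [tuple 5; 6]%N) v.

Definition vol7 (R : realType) : kform R 'rV[R]_8 7 :=
  emono [tuple 1; 2; 3; 4; 5; 6; 7]%N.

(* Hodge star on <E_1, ..., E_7> with E_1, ..., E_7 orthonormal and e^{1234567}
   positive:
     ( *a)(w) = 1/3! sum_(f) a(E_f1, E_f2, E_f3) vol7(E_f1, E_f2, E_f3, w),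
   extended to R^8 so that E_0 is annihilated; [lift ord0] shifts the index
   range {0..6} to {1..7}. *)
Definition star7 (R : realType) (a : kform R 'rV[R]_8 3) : kform R 'rV[R]_8 4 :=
  fun w => (3`!)%:R^-1 *
    \sum_(f : {ffun 'I_3 -> 'I_7})
      let Ef := fun i => delta_mx 0 (lift ord0 (f i)) : 'rV[R]_8 in
      a Ef * vol7 (fun i : 'I_(3 + 4) =>
                     match fintype.split i with inl j => Ef j | inr j => w j end).

Definition Phi0 (R : realType) : kform R 'rV[R]_8 4 :=
  fun v => wedge_form (emono [tuple 0]%N) (@phi0 R) v + star7 (@phi0 R) v.

Definition g0 (R : realType) (v w : 'rV[R]_8) : R := \sum_j v 0 j * w 0 j.

(* [Ck_on k D f] and [smooth_on D f] are meant for open D and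
   finite-dimensional V. *)
Fixpoint Ck_on (R : realType) (V W : normedModType R) (k : nat)
    (D : set V) (f : V -> W) : Prop :=
  match k with
  | 0%N => forall x, D x -> {for x, continuous f}
  | k'.+1 => (forall x, D x -> differentiable f x)
             /\ (forall v, Ck_on k' D ('D_v f))
  end.

Definition smooth_on (R : realType) (V W : normedModType R)
    (D : set V) (f : V -> W) : Prop := forall k, Ck_on k D f.

(* The values of [cmap] outside [cdom] and of [cinv] outside [cmap @` cdom] are
   irrelevant. *)
Record chart (R : realType) (T : topologicalType) (n : nat) := Chart {
  cdom : set T;
  cmap : T -> 'rV[R]_n;
  cinv : 'rV[R]_n -> T;
  cdom_open : open cdom;
  ccod_open : open (cmap @` cdom);
  cmapK : forall p, cdom p -> cinv (cmap p) = p;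
  cmap_cont : {within cdom, continuous cmap};
  cinv_cont : {within cmap @` cdom, continuous cinv} }.

Definition ccod (R : realType) (T : topologicalType) (n : nat)
    (c : chart R T n) : set 'rV[R]_n := cmap c @` cdom c.

(* A smooth n-manifold, with a chosen chart [chart_at p] around each point p.
   The tangent space at p is 'rV[R]_n, a vector being given by its coordinates
   in [chart_at p]. *)
Record manifold (R : realType) (n : nat) := Manifold {
  carrier :> topologicalType;
  mfd_hausdorff : hausdorff_space carrier;
  mfd_second_countable : @second_countable carrier;
  atlas : set (chart R carrier n);
  chart_at : carrier -> chart R carrier n;
  chart_at_atlas : forall p, atlas (chart_at p);
  chart_at_dom : forall p, cdom (chart_at p) p;
  atlas_compat : forall c c', atlas c -> atlas c' ->
    smooth_on (cmap c @` (cdom c `&` cdom c')) (cmap c' \o cinv c) }.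

Arguments atlas {R n} m.
Arguments chart_at {R n} m p.

Definition cpoint (R : realType) (n : nat) (M : manifold R n) (p : M) :
    'rV[R]_n := cmap (chart_at M p) p.

(* differential at p of a map M -> M, as a map T_p M -> T_(f p) M *)
Definition tdiff (R : realType) (n : nat) (M : manifold R n) (f : M -> M)
    (p : M) : 'rV[R]_n -> 'rV[R]_n :=
  'd (cmap (chart_at M (f p)) \o f \o cinv (chart_at M p)) (cpoint p).

(* differential at p of a real-valued function, as a covector on T_p M *)
Definition fdiff (R : realType) (n : nat) (M : manifold R n) (f : M -> R)
    (p : M) : 'rV[R]_n -> R :=
  'd (f \o cinv (chart_at M p)) (cpoint p).

Definition smooth_fun (R : realType) (n : nat) (M : manifold R n)
    (f : M -> R) : Prop :=
  forall c, atlas M c -> smooth_on (ccod c) (f \o cinv c).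

(* the tangent vector at cinv c x with coordinates v in the chart c *)
Definition of_chart (R : realType) (n : nat) (M : manifold R n)
    (c : chart R M n) (x v : 'rV[R]_n) : 'rV[R]_n :=
  'd (cmap (chart_at M (cinv c x)) \o cinv c) x v.

(* local expression in the chart c of a covariant k-tensor field *)
Definition local_expr (R : realType) (n : nat) (M : manifold R n) (k : nat)
    (w : M -> kform R 'rV[R]_n k) (c : chart R M n) (x : 'rV[R]_n) :
    kform R 'rV[R]_n k :=
  fun v => w (cinv c x) (fun i => of_chart c x (v i)).

Definition smooth_tensor (R : realType) (n : nat) (M : manifold R n) (k : nat)
    (w : M -> kform R 'rV[R]_n k) : Prop :=
  forall c, atlas M c ->
  forall v, smooth_on (ccod c) (fun x => local_expr w c x v).

Definition differential_form (R : realType) (n : nat) (M : manifold R n)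
    (k : nat) (w : M -> kform R 'rV[R]_n k) : Prop :=
  (forall p, alternating_form (w p)) /\ smooth_tensor w.

Definition tensor2 (R : realType) (n : nat) (M : manifold R n)
    (g : M -> 'rV[R]_n -> 'rV[R]_n -> R) : M -> kform R 'rV[R]_n 2 :=
  fun p v => g p (v ord0) (v ord_max).

Record riemannian (R : realType) (n : nat) (M : manifold R n)
    (g : M -> 'rV[R]_n -> 'rV[R]_n -> R) : Prop := Riemannian {
  riem_lin : forall p Y, scalar (fun X => g p X Y);
  riem_sym : forall p X Y, g p X Y = g p Y X;
  riem_pos : forall p X, X != 0 -> 0 < g p X X;
  riem_smooth : smooth_tensor (tensor2 g) }.

Definition local_metric (R : realType) (n : nat) (M : manifold R n)
    (g : M -> 'rV[R]_n -> 'rV[R]_n -> R) (c : chart R M n) (x v w : 'rV[R]_n) :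
    R := local_expr (tensor2 g) c x (tnth [tuple v; w]).

(* Christoffel symbols: in the chart c, the Levi-Civita derivative of the
   constant field w along v is the vector [christoffel g c x v w] = G, given by
     2 g(G, z) = D_v g(w, z) + D_w g(v, z) - D_z g(v, w)   for constant z. *)
Definition christoffel (R : realType) (n : nat) (M : manifold R n)
    (g : M -> 'rV[R]_n -> 'rV[R]_n -> R) (c : chart R M n) (x v w : 'rV[R]_n) :
    'rV[R]_n :=
  let E (i : 'I_n) : 'rV[R]_n := delta_mx 0 i in
  let gram : 'M[R]_n := \matrix_(i, j) local_metric g c x (E i) (E j) in
  (\row_k (2^-1 * ('D_v (fun y => local_metric g c y w (E k)) x
                   + 'D_w (fun y => local_metric g c y v (E k)) x
                   - 'D_(E k) (fun y => local_metric g c y v w) x)))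
  *m invmx gram.

(* nabla w = 0 for the Levi-Civita connection of g, in local coordinates *)
Definition parallel (R : realType) (n : nat) (M : manifold R n)
    (g : M -> 'rV[R]_n -> 'rV[R]_n -> R) (k : nat)
    (w : M -> kform R 'rV[R]_n k) : Prop :=
  forall c, atlas M c -> forall x, ccod c x ->
  forall (X : 'rV[R]_n) (v : 'I_k -> 'rV[R]_n),
    'D_X (fun y => local_expr w c y v) x
    - \sum_(i < k) local_expr w c x [eta v with i |-> christoffel g c x X (v i)]
    = 0.

(* A frame is an invertible matrix F, identified with the linear isomorphism
   v |-> v *m F from R^8 to the tangent space. *)
Definition Spin7_frame (R : realType) (Phi : kform R 'rV[R]_8 4)
    (F : 'M[R]_8) : Prop :=
  F \in unitmx /\ forall v, Phi (fun i => v i *m F) = Phi0 v.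

Definition Spin7_structure (R : realType) (M : manifold R 8)
    (Phi : M -> kform R 'rV[R]_8 4) : Prop :=
  differential_form Phi /\ forall p, exists F, Spin7_frame (Phi p) F.

Definition Spin7_metric (R : realType) (M : manifold R 8)
    (Phi : M -> kform R 'rV[R]_8 4) (g : M -> 'rV[R]_8 -> 'rV[R]_8 -> R) :
    Prop :=
  riemannian g /\
  forall p, exists2 F, Spin7_frame (Phi p) F
                     & forall v w, g p (v *m F) (w *m F) = g0 v w.

(* T^m = R^m / Z^m: a T^m-action is given as an action of R^m in which Z^m acts
   trivially; the Lie algebra of T^m is R^m, and its exponential map is the
   projection R^m -> T^m. *)
Definition int_lattice (R : realType) (m : nat) (t : 'rV[R]_m) : Prop :=
  forall i, t 0 i \is a Num.int.

Record torus_action (R : realType) (n : nat) (M : manifold R n) (m : nat)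
    (act : 'rV[R]_m -> M -> M) : Prop := TorusAction {
  act_0 : forall p, act 0 p = p;
  act_D : forall s t p, act (s + t) p = act s (act t p);
  act_lattice : forall t p, int_lattice t -> act t p = p;
  act_cont : continuous (fun z : 'rV[R]_m * M => act z.1 z.2);
  act_smooth : forall c c', atlas M c -> atlas M c' ->
    smooth_on [set z : 'rV[R]_m * 'rV[R]_n |
                 ccod c z.2 /\ cdom c' (act z.1 (cinv c z.2))]
              (fun z => cmap c' (act z.1 (cinv c z.2))) }.

Definition effective (R : realType) (n : nat) (M : manifold R n) (m : nat)
    (act : 'rV[R]_m -> M -> M) : Prop :=
  forall t, (forall p, act t p = p) -> int_lattice t.

Definition preserves (R : realType) (n : nat) (M : manifold R n) (m k : nat)
    (act : 'rV[R]_m -> M -> M) (w : M -> kform R 'rV[R]_n k) : Prop :=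
  forall t p v, w (act t p) (fun i => tdiff (act t) p (v i)) = w p v.

Definition principal (R : realType) (n : nat) (M : manifold R n) (m : nat)
    (act : 'rV[R]_m -> M -> M) : set M :=
  [set p | forall t, act t p = p -> int_lattice t].

(* infinitesimal action: the derivative at s = 0 of s |-> act s p along u *)
Definition xi (R : realType) (n : nat) (M : manifold R n) (m : nat)
    (act : 'rV[R]_m -> M -> M) (u : 'rV[R]_m) (p : M) : 'rV[R]_n :=
  'D_u (fun s : 'rV[R]_m => cmap (chart_at M p) (act s p)) 0.

(* nu p is an element of Lambda^3 (t^4)^*, as an alternating 3-form on
   t^4 = R^4.  Every element of Lambda^3 t^4 is decomposable, so W ranges over
   w_0 /\ w_1 /\ w_2, for which xi(W) -| Phi = Phi(xi w_0, xi w_1, xi w_2, .). *)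
Record multi_moment_map (R : realType) (M : manifold R 8)
    (Phi : M -> kform R 'rV[R]_8 4) (act : 'rV[R]_4 -> M -> M)
    (nu : M -> kform R 'rV[R]_4 3) : Prop := MultiMomentMap {
  mmm_alt : forall p, alternating_form (nu p);
  mmm_smooth : forall w, smooth_fun (fun p => nu p w);
  mmm_inv : forall t p, nu (act t p) = nu p;
  mmm_diff : forall (w : 'I_3 -> 'rV[R]_4) p X,
    fdiff (fun q => nu q w) p X =
    Phi p (tnth [tuple xi act (w (inord 0)) p; xi act (w (inord 1)) p;
                       xi act (w (inord 2)) p; X]) }.

Record toric_Spin7 (R : realType) (M : manifold R 8)
    (Phi : M -> kform R 'rV[R]_8 4) (g : M -> 'rV[R]_8 -> 'rV[R]_8 -> R)
    (act : 'rV[R]_4 -> M -> M) : Prop := ToricSpin7 {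
  toric_connected : connected [set: M];
  toric_Spin7_structure : Spin7_structure Phi;
  toric_metric : Spin7_metric Phi g;
  toric_torsion_free : parallel g Phi;
  toric_action : torus_action act;
  toric_preserves : preserves act Phi;
  toric_effective : effective act;
  toric_multi_hamiltonian : exists nu, multi_moment_map Phi act nu }.

(* The rows of the invertible matrix u are a basis u_0, ..., u_3 of t^4. *)
Definition torus_generator (R : realType) (M : manifold R 8)
    (act : 'rV[R]_4 -> M -> M) (u : 'M[R]_4) (i : 'I_4) (p : M) : 'rV[R]_8 :=
  xi act (row i u) p.

Definition gramB (R : realType) (M : manifold R 8)
    (g : M -> 'rV[R]_8 -> 'rV[R]_8 -> R) (U : 'I_4 -> M -> 'rV[R]_8) (p : M) :
    'M[R]_4 := \matrix_(i, j) g p (U i p) (U j p).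

Definition dual_one_forms (R : realType) (M : manifold R 8)
    (g : M -> 'rV[R]_8 -> 'rV[R]_8 -> R) (U : 'I_4 -> M -> 'rV[R]_8)
    (D : set M) (theta : 'I_4 -> M -> 'rV[R]_8 -> R) : Prop :=
  forall p, D p -> forall i,
    [/\ scalar (theta i p),
        forall j, theta i p (U j p) = (i == j)%:R
      & forall X, (forall j, g p X (U j p) = 0) -> theta i p X = 0].

(* nu_i = (-1)^i <nu, u_j /\ u_k /\ u_l>, (ijkl) cyclic; [ordS] is the cyclic
   successor. *)
Definition nu_comp (R : realType) (M : manifold R 8)
    (nu : M -> kform R 'rV[R]_4 3) (u : 'M[R]_4) (i : 'I_4) (p : M) : R :=
  (-1) ^+ i * nu p (tnth [tuple row (ordS i) u; row (ordS (ordS i)) u;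
                                row (ordS (ordS (ordS i))) u]).

(* Main.v *)
Require Import Defs.
From HB Require Import structures.
From mathcomp Require Import all_boot all_order all_algebra all_fingroup.
From mathcomp Require Import all_classical all_reals all_analysis.
From mathcomp Require Import ring lra.

Set Implicit Arguments.
Unset Strict Implicit.
Unset Printing Implicit Defensive.

Import Order.TTheory GRing.Theory Num.Theory.
Import numFieldNormedType.Exports.

Local Open Scope classical_set_scope.
Local Open Scope ring_scope.

(** The statement is pointwise: at p it only involves the form [Phi p], the
    metric [g p], the four generators U_i, the dual forms theta_i and the
    covectors dnu_i. A Spin(7)-frame identifies ([Phi p], [g p]) with the
    standard pair, so it is linear algebra for the Cayley form plus a single
    fact about the torus action.

    That fact is [torus_isotropic]: nu is constant along orbits, so dnu vanishes
    on the generators, and by the defining property of nu this says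
    Phi(U_0, U_1, U_2, U_3) = 0.

    The linear algebra rests on the triple cross product P, defined by
    g(P(x,y,z), w) = Phi(x,y,z,w), and on one identity for it,
    [cross_identity]: g(P(x,y,z), P(a,b,c)) is the Gram determinant of the two
    triples plus a sum of nine terms g(x_i, a_j) Phi(x_k, x_l, a_m, a_n). Both
    sides are alternating in (x,y,z) and in (a,b,c), so the identity need only
    be checked on increasing triples of basis vectors, where it is a statement
    about the integer structure constants of the Cayley form.

    The covector dnu_i is dual to the vector X_i = (-1)^i P(U_j, U_k, U_l). By
    isotropy X_i is orthogonal to every U_j, and all correction terms disappear
    from the identity applied to the X_i, which becomes g(X_i, X_j) = adj(B)_ij.
    The theta_i force B to be invertible, hence (U_0, ..., U_3, X_0, ..., X_3)
    is a basis. In it the Gram matrix is block diagonal with blocks B and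
    adj(B), which is the formula for g since V = B^-1.

    For Phi, both sides are alternating and are compared on increasing tuples
    of that basis, in five cases according to the number of X's. If X_m is the
    last argument, Phi(x,y,z,X_m) = +- g(P(x,y,z), P(U,U,U)), and the identity
    expresses it through values with fewer X's: one finds +- adj(B)_lm on UUUX,
    det(B) times a determinant of Kronecker deltas on UUXX, +- det(B) B_al on
    UXXX and 0 on XXXX ([Phi_UUUX], [Phi_UUXX], [Phi_UXXX], [Phi_XXXX]). The
    right-hand side takes the same values because B adj(B) = det(B) and
    adj(adj(B)) = det(B)^2 B. *)

(** * Alternating forms *)

(** A permutation of n+1 points is the image of the first point together with
    a permutation of the others; iterating this turns sums over small symmetric
    groups into explicit sums. *)
Lemma sum_perm_recl (R : nzRingType) n (F : 'S_n.+1 -> R) :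
  \sum_s F s = \sum_i \sum_(s : 'S_n) F (lift_perm ord0 i s).
Proof.
rewrite pair_bigA /=.
have inj : injective (fun q : 'I_n.+1 * 'S_n => lift_perm ord0 q.1 q.2).
  move=> [i s] [j t] /= E.
  have ij : i = j by move/permP/(_ ord0): E; rewrite !lift_perm_id.
  rewrite -{j}ij in E *; congr pair; apply/permP => k.
  by move/permP/(_ (lift ord0 k)): E; rewrite !lift_perm_lift => /lift_inj.
apply: reindex; apply: onW_bij; apply: inj_card_bij => //.
by rewrite card_prod card_ord !card_Sn factS.
Qed.

Lemma sign_lift_perm (R : nzRingType) n i (s : 'S_n) :
  (-1) ^+ lift_perm ord0 i s = (-1) ^+ i * (-1) ^+ s :> R.
Proof. by rewrite odd_lift_perm [X in _ ^+ X = _]/= signr_addb signr_odd. Qed.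

Section Alternating.
Context {R : realType} {E : lmodType R}.

Lemma alternating_slot_lin k (a : kform R E k) (aP : alternating_form a)
    (v : 'I_k -> E) i (c : R) x y :
  a [eta v with i |-> c *: x + y]
  = c * a [eta v with i |-> x] + a [eta v with i |-> y].
Proof. by rewrite (aP.1 v i c x y). Qed.

Lemma scalar_sum (f : E -> R) (fP : scalar f) n (c : 'I_n -> R)
    (e : 'I_n -> E) :
  f (\sum_i c i *: e i) = \sum_i c i * f (e i).
Proof.
have f0 : f 0 = 0.
  by have := fP (-1) 0 0; rewrite scaler0 addr0 mulN1r addNr.
elim: n => [|n IH] in c e *; first by rewrite !big_ord0.
by rewrite !big_ord_recl fP IH.
Qed.

Lemma alternating_tperm k (a : kform R E k) (aP : alternating_form a) v i j :
  i != j -> a (v \o tperm i j) = - a v.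
Proof.
move=> ij; pose w x y : 'I_k -> E := [eta [eta v with j |-> y] with i |-> x].
have wsym x y : w x y = ([eta [eta v with i |-> x] with j |-> y] : _ -> _).
  apply/funext => l; rewrite /w /=.
  by case: (eqVneq l i) => [->|//]; rewrite (negbTE ij).
have w0 x : a (w x x) = 0.
  by apply: (aP.2 _ i j ij); rewrite /w /= eqxx eq_sym (negbTE ij) eqxx.
have addl x x' y : a (w (x + x') y) = a (w x y) + a (w x' y).
  by rewrite -[x in w (x + _)]scale1r alternating_slot_lin // mul1r.
have addr x y y' : a (w x (y + y')) = a (w x y) + a (w x y').
  by rewrite !wsym -[y in X in a X = _]scale1r alternating_slot_lin // mul1r.
have := w0 (v i + v j); rewrite addl !addr !w0 add0r addr0 => /eqP.
rewrite addrC addr_eq0 => /eqP E1.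
rewrite (_ : v \o tperm i j = w (v j) (v i)); last first.
  apply/funext => l; rewrite /w /=.
  by case: tpermP => [->|->|/eqP/negbTE-> /eqP/negbTE->]; rewrite ?eqxx //
    eq_sym (negbTE ij).
rewrite E1; congr (- a _); apply/funext => l; rewrite /w /=.
by case: (eqVneq l i) => [->//|_]; case: (eqVneq l j) => [->|].
Qed.

Lemma alternating_perm k (a : kform R E k) (aP : alternating_form a) v
    (s : 'S_k) :
  a (v \o s) = (-1) ^+ s * a v.
Proof.
have [ts -> /allP ne] := prod_tpermP s.
elim: ts v ne => [|t ts IH] v ne.
  rewrite big_nil odd_perm1 mul1r; congr a.
  by apply/funext => i /=; rewrite perm1.
have tne : t.1 != t.2 := ne t (mem_head _ _).
rewrite big_cons odd_mul_tperm tne signr_addb expr1 mulN1r mulNr.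
rewrite -(IH v) => [|u uts]; last by apply: ne; rewrite inE uts orbT.
rewrite -(alternating_tperm aP _ tne); congr a.
by apply/funext => i /=; rewrite permM.
Qed.

(** Multilinearity expands every argument over the spanning family, and a sort
    puts the resulting tuple in increasing order up to a sign, unless it has a
    repetition. *)
Lemma alternating_eq0 k n (a : kform R E k) (e : 'I_n -> E) :
    alternating_form a ->
    (forall x, exists c : 'I_n -> R, x = \sum_i c i *: e i) ->
    (forall f : 'I_k -> 'I_n, {homo f : i j / (i < j)%N} -> a (e \o f) = 0) ->
  forall v, a v = 0.
Proof.
move=> aP span a0.
have a0' (f : 'I_k -> 'I_n) : a (e \o f) = 0.
  have [/injectiveP finj|/injectivePn[i [j ij fij]]] := boolP (injectiveb f);
    last by apply: (aP.2 _ i j ij) => /=; rewrite fij.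
  pose t := [tuple f i | i < k].
  pose le := fun x y : 'I_n => (x <= y)%N.
  pose t' := [tuple of sort le t].
  have le_tot : total le by move=> x y; exact: leq_total.
  have : perm_eq t' t by rewrite perm_sort.
  move=> /tuple_permP[s ts].
  have tE i : tnth t' i = f (s i).
    have -> : t' = [tuple tnth t (s i) | i < k] by exact: val_inj.
    by rewrite !tnth_mktuple.
  have : a (e \o (f \o s)) = 0.
    apply: a0 => i j ij /=; rewrite ltn_neqAle; apply/andP; split.
      apply: contraTneq ij => /(@ord_inj n)/finj/perm_inj ->.
      by rewrite ltnn.
    have le_tr : transitive le by move=> x y z; exact: leq_trans.
    have := sort_sorted le_tot t.
    move=> /(sorted_leq_nth le_tr (fun x => leqnn x) (f i)) /(_ i j).
    rewrite !inE !size_sort !size_tuple !ltn_ord => /(_ isT isT (ltnW ij)).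
    by rewrite -!(tnth_nth _ t') !tE.
  rewrite compA alternating_perm // => /eqP.
  by rewrite mulf_eq0 signr_eq0 => /eqP.
(* Arguments are expanded one at a time: those of index at least m are already
   members of the family e. *)
move=> v.
suff H m : (m <= k)%N ->
    forall v, (forall i : 'I_k, (m <= i)%N -> exists j, v i = e j) -> a v = 0.
  by apply: (H k) => // i; rewrite leqNgt ltn_ord.
elim: m => [_ w wP|m IH mk w wP].
  have [f fP] := choice (fun i => wP i isT).
  by rewrite (_ : w = e \o f)//; apply/funext.
have [c cP] := span (w (Ordinal mk)).
have -> : w = [eta w with Ordinal mk |-> \sum_i c i *: e i].
  by apply/funext => i; rewrite /= -cP; case: eqP => [->|].
rewrite (scalar_sum (aP.1 w _)) big1// => i _; rewrite IH ?mulr0 ?(ltnW mk)//.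
move=> j mj; rewrite /=; case: eqP => [_|/eqP jm]; first by exists i.
by apply: wP; rewrite ltn_neqAle mj andbT eq_sym; apply: contra jm.
Qed.

Lemma alternating_lin k (c : R) (a b : kform R E k) :
  alternating_form a -> alternating_form b ->
  alternating_form (fun v => c * a v + b v).
Proof.
move=> aP bP; split=> [v i x y z|v i j ij vij]; last first.
  by rewrite (aP.2 _ _ _ ij) // (bP.2 _ _ _ ij) // mulr0 addr0.
by rewrite aP.1 bP.1; ring.
Qed.

Lemma alternating_add k (a b : kform R E k) :
  alternating_form a -> alternating_form b ->
  alternating_form (fun v => a v + b v).
Proof.
move=> aP bP; rewrite (_ : (fun v => _) = (fun v => 1 * a v + b v)).
  exact: alternating_lin.
by apply/funext => v; rewrite mul1r.
Qed.

Lemma alternating_scale k (c : R) (a : kform R E k) :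
  alternating_form a -> alternating_form (fun v => c * a v).
Proof.
move=> aP; split=> [v i x y z|v i j ij vij].
  by rewrite aP.1; ring.
by rewrite (aP.2 _ _ _ ij) // mulr0.
Qed.

Lemma alternating_sum k I (r : seq I) (F : I -> kform R E k) :
  (forall i, alternating_form (F i)) ->
  alternating_form (fun v => \sum_(i <- r) F i v).
Proof.
move=> FP; elim: r => [|i r IH].
  split=> [v i x y z|v i j ij vij]; rewrite !big_nil // mulr0 addr0 //.
rewrite (_ : (fun v => _) = (fun v => F i v + \sum_(i <- r) F i v)).
  exact: alternating_add.
by apply/funext => v; rewrite big_cons.
Qed.

Lemma alternating_wedge_list k (a : k.-tuple (E -> R)) :
  (forall i, scalar (tnth a i)) -> alternating_form (wedge_list a).
Proof.
move=> aP; split=> [v i x y z|v i j ij vij]; rewrite /wedge_list.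
  rewrite -[LHS]det_tr -[X in _ = _ + X]mul1r -[X in _ = *%R x X + _]det_tr.
  rewrite -[X in _ = _ + 1 * X]det_tr.
  apply: (determinant_multilinear (i0 := i)).
  - by apply/rowP => l; rewrite !mxE /= eqxx aP mul1r.
  - apply/matrixP => l m; rewrite !mxE /=.
    by rewrite [lift i l == i]eq_sym (negbTE (neq_lift i l)).
  - apply/matrixP => l m; rewrite !mxE /=.
    by rewrite [lift i l == i]eq_sym (negbTE (neq_lift i l)).
rewrite -det_tr; apply: (determinant_alternate ij) => l.
by rewrite !mxE vij.
Qed.

(** The permutations that put the i-th vector in the one-form all contribute the
    same term, by alternation of b; there are k! of them, which the
    normalisation of [wedge_form] divides out. *)
Lemma wedge1_form k (a : E -> R) (b : kform R E k) (bP : alternating_form b)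
    (v : 'I_(1 + k) -> E) :
  wedge_form (wedge_list [tuple a]) b v
  = \sum_(i < k.+1) (-1) ^+ i * a (v i) * b (v \o lift i).
Proof.
rewrite /wedge_form (_ : 1`! * k`! = k`!)%N; last by rewrite -[RHS]mul1n.
rewrite sum_perm_recl mulr_sumr.
apply: eq_bigr => i _; transitivity ((k`!)%:R^-1 *
   \sum_(s : 'S_k) ((-1) ^+ i * a (v i) * b (v \o lift i))).
  congr (_ * _); apply: eq_bigr => s _.
  rewrite /wedge_list det_mx11 !mxE.
  rewrite (_ : lshift k 0 = ord0) ?lift_perm_id; last exact: val_inj.
  rewrite (_ : (fun j => _) = (v \o lift i) \o s); last first.
    apply/funext => j /=; rewrite (_ : rshift 1 j = lift ord0 j).
      by rewrite lift_perm_lift.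
    exact: val_inj.
  rewrite alternating_perm // sign_lift_perm tnth0 mulrACA -[X in X * _]mulrA.
  by rewrite -signr_addb addbb mulr1 mulrA.
by rewrite sumr_const card_Sn -[X in _ * X]mulr_natl mulKf //.
Qed.

Lemma wedge_list_cons k (a : E -> R) (t : k.-tuple (E -> R))
    (v : 'I_k.+1 -> E) :
  wedge_list [tuple of a :: t] v
  = \sum_(i < k.+1) (-1) ^+ i * a (v i) * wedge_list t (v \o lift i).
Proof.
rewrite /wedge_list (expand_det_row _ ord0); apply: eq_bigr => i _.
rewrite !mxE /= mulrA [_ * a _]mulrC; congr (_ * _ * \det _).
by apply/matrixP => l m; rewrite !mxE !(tnth_nth a).
Qed.

End Alternating.

(** * Squares of two-forms, and forms as curried functions *)

Section Explicit.
Context {R : realType} {E : lmodType R}.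

Lemma tuple2E (v : 'I_2 -> E) : v = tnth [tuple v ord0; v ord_max].
Proof.
apply/funext => -[[|[|//]] i2] /=; rewrite (tnth_nth (v ord0)) /=;
  by congr v; apply: val_inj.
Qed.

Lemma tuple4E (v : 'I_4 -> E) :
  v = tnth [tuple v (inord 0); v (inord 1); v (inord 2); v (inord 3)].
Proof.
apply/funext => -[[|[|[|[|//]]]] i4] /=; rewrite (tnth_nth (v ord0)) /=;
  by congr v; apply: val_inj; rewrite /= inordK.
Qed.

Lemma alternating2C (a : kform R E 2) (aP : alternating_form a) x y :
  a (tnth [tuple y; x]) = - a (tnth [tuple x; y]).
Proof.
rewrite -(@alternating_tperm _ _ _ _ aP _ ord0 ord_max) //; congr a.
by rewrite [_ \o _]tuple2E /= tpermL tpermR !(tnth_nth x).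
Qed.

(** The 24 permutations fall into three classes of eight, one for each way to
    split four vectors into two pairs; the normalisation 1 / (2! 2!) leaves the
    factor 2. *)
Lemma wedge_form_square2 (a : kform R E 2) (aP : alternating_form a) x y z w :
  wedge_form a a (tnth [tuple x; y; z; w])
  = 2 * (a (tnth [tuple x; y]) * a (tnth [tuple z; w])
         - a (tnth [tuple x; z]) * a (tnth [tuple y; w])
         + a (tnth [tuple x; w]) * a (tnth [tuple y; z])).
Proof.
(* Given the first two images i and lift i j, the two remaining permutations
   contribute equally. *)
set v := tnth _.
have term (i : 'I_4) (j : 'I_3) :
    \sum_(s : 'S_2) (let t := lift_perm ord0 i (lift_perm ord0 j s) in
      (-1) ^+ t * a (fun l => v (t (lshift 2 l))) *
                  a (fun l => v (t (rshift 2 l))))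
    = 2 * ((-1) ^+ (i + j) * a (tnth [tuple v i; v (lift i j)]) *
        a (tnth [tuple v (lift i (lift j ord0)); v (lift i (lift j ord_max))])).
  pose c := (-1) ^+ (i + j) * a (tnth [tuple v i; v (lift i j)]) *
        a (tnth [tuple v (lift i (lift j ord0)); v (lift i (lift j ord_max))]).
  rewrite -/c; transitivity (\sum_(s : 'S_2) c); last first.
    by rewrite sumr_const card_Sn mulr_natl.
  apply: eq_bigr => s _ /=.
  have e0 : lshift 2 ord0 = ord0 :> 'I_(2 + 2) by exact: val_inj.
  have e1 : lshift 2 (@ord_max 1) = lift ord0 ord0 :> 'I_(2 + 2) by exact: val_inj.
  have e2 l : rshift 2 l = lift ord0 (lift ord0 l) :> 'I_(2 + 2) by exact: val_inj.
  rewrite [fun l => v (_ (lshift _ _))]tuple2E /= e0 e1 !lift_perm_id.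
  rewrite !lift_perm_lift lift_perm_id.
  rewrite [fun l => v (_ (rshift _ _))](_ : _ = (v \o lift i \o lift j) \o s);
    last by apply/funext => l /=; rewrite e2 !lift_perm_lift.
  rewrite alternating_perm // [_ \o _ \o _]tuple2E /= !sign_lift_perm /c exprD.
  have ss : (-1) ^+ s * (-1) ^+ s = 1 :> R by rewrite -signr_addb addbb.
  move: ((-1) ^+ s) ss => e ss.
  by rewrite -[RHS]mul1r -ss; ring.
rewrite /wedge_form sum_perm_recl.
under eq_bigr => i _ do rewrite sum_perm_recl (eq_bigr _ (fun j _ => term i j)).
rewrite !big_ord_recl !big_ord0 /=.
rewrite /v !(tnth_nth x) /= !(alternating2C aP x y) !(alternating2C aP x z).
rewrite !(alternating2C aP x w) !(alternating2C aP y z) !(alternating2C aP y w).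
rewrite !(alternating2C aP z w) (_ : (2`! * 2`!)%N = 4%N) // /bump.
rewrite !leq0n !addn0 !add0n !add1n !addnS !addn0 !exprS !expr0.
by field.
Qed.
End Explicit.

Section Curried.
Context {R : realType} {E : lmodType R}.

(** Linearity is only asked in the first slot: antisymmetry moves it to the
    others. *)
Lemma alternating_form3 (f : E -> E -> E -> R) :
    (forall y z, scalar (fun x => f x y z)) ->
    (forall x y z, f y x z = - f x y z) -> (forall x y z, f x z y = - f x y z) ->
  alternating_form (fun v : 'I_3 -> E => f (v (inord 0)) (v (inord 1)) (v (inord 2))).
Proof.
move=> flin f12 f23.
have e (i j : nat) : (i < 3)%N -> (j < 3)%N -> (inord i == inord j :> 'I_3) = (i == j).
  by move=> i3 j3; rewrite -val_eqE /= !inordK.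
have eo (k : nat) (k3 : (k < 3)%N) : Ordinal k3 = inord k.
  by apply: val_inj; rewrite /= inordK.
have f2 x z c y y' : f x (c *: y + y') z = c * f x y z + f x y' z.
  by rewrite f12 flin ![f _ x z]f12; ring.
have f3 x y c z z' : f x y (c *: z + z') = c * f x y z + f x y z'.
  by rewrite f23 f2 ![f x _ y]f23; ring.
have f0 x z : f x x z = 0 by apply/eqP; rewrite -[_ == _]eqNr -f12.
have f0' x z : f z x x = 0 by apply/eqP; rewrite -[_ == _]eqNr -f23.
split=> [v [[|[|[|//]]] i3] c x y|v [[|[|[|//]]] i3] [[|[|[|//]]] j3]];
  rewrite ?(eo _ i3) ?(eo _ j3) /= ?e //= ?flin ?f2 ?f3 // => _ E1;
  rewrite ?E1 ?f0 ?f0' //; by rewrite f23 ?E1 ?f0 ?oppr0 // -E1 ?f0 ?oppr0.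
Qed.

Lemma alternating_form4 (f : E -> E -> E -> E -> R) :
    (forall y z w, scalar (fun x => f x y z w)) ->
    (forall x y z w, f y x z w = - f x y z w) ->
    (forall x y z w, f x z y w = - f x y z w) ->
    (forall x y z w, f x y w z = - f x y z w) ->
  alternating_form (fun v : 'I_4 -> E =>
    f (v (inord 0)) (v (inord 1)) (v (inord 2)) (v (inord 3))).
Proof.
move=> flin f12 f23 f34.
have e (i j : nat) : (i < 4)%N -> (j < 4)%N -> (inord i == inord j :> 'I_4) = (i == j).
  by move=> i3 j3; rewrite -val_eqE /= !inordK.
have eo (k : nat) (k3 : (k < 4)%N) : Ordinal k3 = inord k.
  by apply: val_inj; rewrite /= inordK.
have f2 x z w c y y' : f x (c *: y + y') z w = c * f x y z w + f x y' z w.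
  by rewrite f12 flin ![f _ x z w]f12; ring.
have f3 x y w c z z' : f x y (c *: z + z') w = c * f x y z w + f x y z' w.
  by rewrite f23 f2 ![f x _ y w]f23; ring.
have f4 x y z c w w' : f x y z (c *: w + w') = c * f x y z w + f x y z w'.
  by rewrite f34 f3 ![f x y _ z]f34; ring.
have f0 x z w : f x x z w = 0 by apply/eqP; rewrite -[_ == _]eqNr -f12.
have f0' x z w : f z x x w = 0 by apply/eqP; rewrite -[_ == _]eqNr -f23.
have f0'' x z w : f z w x x = 0 by apply/eqP; rewrite -[_ == _]eqNr -f34.
have f13 x y z : f x y x z = 0 by rewrite f23 f0 oppr0.
have f24 x y z : f z x y x = 0 by rewrite f34 f0' oppr0.
have f14 x y z : f x y z x = 0 by rewrite f34 f13 oppr0.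
split=> [v [[|[|[|[|//]]]] i3] c x y|v [[|[|[|[|//]]]] i3] [[|[|[|[|//]]]] j3]];
  rewrite ?(eo _ i3) ?(eo _ j3) /= ?e //= ?flin ?f2 ?f3 ?f4 // => _ E1;
  by rewrite ?E1 ?f0 ?f0' ?f0'' ?f13 ?f24 ?f14 // -E1 ?f0 ?f0' ?f0'' ?f13 ?f24 ?f14.
Qed.

Variable a : kform R E 4.
Hypothesis aP : alternating_form a.
Let f x y z w := a (tnth [tuple x; y; z; w]).

Lemma curry4C12 x y z w : f y x z w = - f x y z w.
Proof.
rewrite /f -(@alternating_tperm _ _ _ _ aP _ (inord 0) (inord 1)); last first.
  by rewrite -val_eqE /= !inordK.
rewrite [_ \o _]tuple4E /= tpermL tpermR !tpermD -?val_eqE /= ?inordK //.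
by rewrite !(tnth_nth x) /= !inordK.
Qed.

Lemma curry4C23 x y z w : f x z y w = - f x y z w.
Proof.
rewrite /f -(@alternating_tperm _ _ _ _ aP _ (inord 1) (inord 2)); last first.
  by rewrite -val_eqE /= !inordK.
rewrite [_ \o _]tuple4E /= tpermL tpermR !tpermD -?val_eqE /= ?inordK //.
by rewrite !(tnth_nth x) /= !inordK.
Qed.

Lemma curry4C34 x y z w : f x y w z = - f x y z w.
Proof.
rewrite /f -(@alternating_tperm _ _ _ _ aP _ (inord 2) (inord 3)); last first.
  by rewrite -val_eqE /= !inordK.
rewrite [_ \o _]tuple4E /= tpermL tpermR !tpermD -?val_eqE /= ?inordK //.
by rewrite !(tnth_nth x) /= !inordK.
Qed.

Lemma curry4lin y z w : scalar (fun x => f x y z w).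
Proof.
have upd u : tnth [tuple u; y; z; w]
    = [eta tnth [tuple 0; y; z; w] with inord 0 |-> u] :> ('I_4 -> E).
  rewrite [RHS]tuple4E /= -!val_eqE /= !inordK //= !(tnth_nth 0) /= !inordK //.
by move=> c x x'; rewrite /f (upd x) (upd x') (upd (c *: x + x')) alternating_slot_lin.
Qed.

End Curried.

(** * Determinants of matrices indexed by [nat] *)

(** Indexing the entries by [nat] makes minors computable: deleting row r and
    column 0 is the substitution of [bump r a] and [b.+1]. *)
Definition ndet (R : comNzRingType) n (f : nat -> nat -> R) : R :=
  \det (\matrix_(i < n, j < n) f i j).

Section NatDet.
Context {R : comNzRingType}.
Implicit Types f : nat -> nat -> R.

Lemma ndet_recl n f :
  ndet n.+1 f
  = \sum_(i < n.+1) (-1) ^+ i * f 0%N i * ndet n (fun a b => f a.+1 (bump i b)).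
Proof.
rewrite /ndet (expand_det_row _ ord0); apply: eq_bigr => i _.
rewrite !mxE /= mulrA [_ * f _ _]mulrC; congr (_ * _ * \det _).
by apply/matrixP => l m; rewrite !mxE.
Qed.

Lemma ndet_delta n f r : (r < n.+1)%N ->
  (forall i, (i < n.+1)%N -> f i 0%N = (i == r)%:R) ->
  ndet n.+1 f = (-1) ^+ r * ndet n (fun a b => f (bump r a) b.+1).
Proof.
move=> rn fr; rewrite /ndet (expand_det_col _ ord0) (bigD1 (Ordinal rn)) //=.
rewrite !mxE fr //= eqxx mul1r big1 => [|i /negbTE ir].
  rewrite addr0 /cofactor addn0; congr (_ * \det _).
  by apply/matrixP => a b; rewrite !mxE.
by rewrite !mxE fr // -[r]/(val (Ordinal rn)) val_eqE ir mul0r.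
Qed.

Lemma adj_ndet n f (i j : 'I_n.+1) :
  (\adj (\matrix_(r < n.+1, s < n.+1) f r s)) i j
  = (-1) ^+ (j + i) * ndet n (fun r s => f (bump j r) (bump i s)).
Proof.
rewrite mxE /cofactor; congr (_ * \det _).
by apply/matrixP => r s; rewrite !mxE.
Qed.

Lemma ndet2 f : ndet 2 f = f 0 0 * f 1 1 - f 0 1 * f 1 0.
Proof.
rewrite !ndet_recl !big_ord_recl !big_ord0 /= /bump !ndet_recl !big_ord_recl !big_ord0 /=.
by rewrite /ndet det_mx00 /=; ring.
Qed.

Lemma ndet3 f : ndet 3 f =
  f 0 0 * (f 1 1 * f 2 2 - f 1 2 * f 2 1)
  - f 0 1 * (f 1 0 * f 2 2 - f 1 2 * f 2 0)
  + f 0 2 * (f 1 0 * f 2 1 - f 1 1 * f 2 0).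
Proof.
by rewrite ndet_recl !big_ord_recl big_ord0 !ndet2 /= /bump /=; ring.
Qed.

(** Laplace expansion along the first row of a zero-one matrix. Unlike the
    determinant it evaluates, and it never descends into the minor of a zero
    entry. *)
Fixpoint bdet n (f : nat -> nat -> bool) : int :=
  if n is m.+1 then
    foldr (fun i acc => (if f 0%N i then
      let d := bdet m (fun a b => f a.+1 (bump i b)) in
      if odd i then - d else d else 0) + acc) 0 (iota 0 n)
  else 1.

Lemma ndet_bdet n (f : nat -> nat -> bool) :
  ndet n (fun i j => (f i j)%:R) = (bdet n f)%:~R :> R.
Proof.
elim: n f => [|n IH] f; first by rewrite /ndet det_mx00.
rewrite ndet_recl -(big_mkord predT
  (fun i => (-1) ^+ i * (f 0%N i)%:R * ndet n (fun a b => (f a.+1 (bump i b))%:R))).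
rewrite [in RHS]/bdet -/bdet /index_iota subn0.
elim: (iota 0 n.+1) => [|i s IHs]; first by rewrite big_nil.
rewrite big_cons IHs /= rmorphD /= IH -signr_odd; congr (_ + _).
by case: (f _ _); case: (odd i);
  rewrite ?mulr0 ?mul0r ?mulr1 ?expr1 ?expr0 ?mulN1r ?mul1r ?rmorphN.
Qed.

End NatDet.

Lemma wedge_listE (R : realType) (E : lmodType R) k (t : k.-tuple (E -> R))
    (v : k.-tuple E) a x :
  wedge_list t (tnth v) = ndet k (fun i j => nth a t i (nth x v j)).
Proof.
by rewrite /wedge_list; congr (\det _); apply/matrixP => i j;
  rewrite !mxE !(tnth_nth a) !(tnth_nth x).
Qed.

Lemma coordf_scalar (R : realType) a : scalar (@coordf R a).
Proof. by move=> c x y; rewrite /coordf !mxE. Qed.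

Lemma alternating_emono (R : realType) k (t : k.-tuple nat) :
  alternating_form (@emono R k t).
Proof.
apply: alternating_wedge_list => i; rewrite tnth_map; exact: coordf_scalar.
Qed.

(** * The Cayley form as a sum of fourteen monomials *)

Section StarMono.
Context {R : realType} {E : lmodType R}.

(** The permutation s in the expansion of the determinant selects the single
    index function f = t o s^-1, and both factors then contribute the sign of s.
    Applied to the volume form this evaluates the Hodge star of a monomial. *)
Lemma sum_det_delta k n (F : kform R E k) (FP : alternating_form F)
    (e : 'I_n -> E) (t : 'I_k -> 'I_n) :
  \sum_(f : {ffun 'I_k -> 'I_n})
     \det (\matrix_(i, j) (f j == t i)%:R) * F (e \o f)
  = (k`!)%:R * F (e \o t).
Proof.
under eq_bigr => f _ do rewrite /determinant mulr_suml.
rewrite exchange_big /=.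
transitivity (\sum_(s : 'S_k) F (e \o t)); last first.
  by rewrite sumr_const card_Sn mulr_natl.
apply: eq_bigr => s _; pose f0 := [ffun i => t ((s^-1)%g i)].
rewrite (bigD1 f0) //= [X in _ + X]big1 => [|f ff0].
  rewrite addr0 big1 ?mulr1 => [|i _]; last first.
    by rewrite !mxE ffunE permK eqxx.
  rewrite (_ : e \o f0 = (e \o t) \o (s^-1)%g); last first.
    by apply/funext => i /=; rewrite ffunE.
  by rewrite alternating_perm // odd_permV mulrA -signr_addb addbb mul1r.
have /existsP[i fi] : [exists i, f (s i) != t i].
  move: ff0; apply: contraNT; rewrite negb_exists => /forallP ft.
  apply/eqP/ffunP => i; rewrite ffunE; have := ft ((s^-1)%g i).
  by rewrite negbK permKV => /eqP.
by rewrite (bigD1 i) //= !mxE (negbTE fi) mul0r mulr0 mul0r.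
Qed.

End StarMono.

Section Cayley.
Context {R : realType}.
Local Notation E8 := 'rV[R]_8.

Lemma emono_cons k a (t : k.-tuple nat) (v : 'I_k.+1 -> E8) :
  emono [tuple of a :: t] v
  = \sum_(i < k.+1) (-1) ^+ i * coordf a (v i) * emono t (v \o lift i).
Proof.
rewrite /emono -wedge_list_cons; congr (wedge_list _ _); exact: val_inj.
Qed.

Lemma wedge_emono1 k a (b : kform R E8 k) (bP : alternating_form b) v :
  wedge_form (emono [tuple a]) b v
  = \sum_(i < k.+1) (-1) ^+ i * coordf a (v i) * b (v \o lift i).
Proof.
rewrite -(wedge1_form _ bP); congr (wedge_form (wedge_list _) _ _).
exact: val_inj.
Qed.

Lemma phi0E (v : 'I_3 -> E8) :
  phi0 v = emono [tuple 1; 2; 3]%N v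
    - (emono [tuple 1; 4; 5]%N v + emono [tuple 1; 6; 7]%N v)
    - (emono [tuple 2; 4; 6]%N v + emono [tuple 2; 7; 5]%N v)
    - (emono [tuple 3; 4; 7]%N v + emono [tuple 3; 5; 6]%N v).
Proof.
have w a b c d e : wedge_form (emono [tuple a]) (emono [tuple b; c] \+ emono [tuple d;
  e]) v
    = emono [tuple a; b; c] v + emono [tuple a; d; e] v.
  rewrite wedge_emono1; last by apply: alternating_add; exact: alternating_emono.
  rewrite (_ : [tuple a; b; c] = [tuple of a :: [tuple b; c]]); last exact: val_inj.
  rewrite (_ : [tuple a; d; e] = [tuple of a :: [tuple d; e]]); last exact: val_inj.
  rewrite !emono_cons -big_split; apply: eq_bigr => i _ /=; ring.
by rewrite /phi0 !w.
Qed.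

(** The contraction of the volume form of the last seven coordinates with the
    vectors w placed last. *)
Definition contract7 (w : 'I_4 -> E8) : kform R E8 3 := fun x =>
  vol7 (fun i : 'I_(3 + 4) =>
          match fintype.split i with inl j => x j | inr j => w j end).

Lemma alternating_contract7 w : alternating_form (contract7 w).
Proof.
have vP := @alternating_emono R 7 [tuple 1; 2; 3; 4; 5; 6; 7]%N.
split=> [x i c y z|x i j ij xij]; rewrite /contract7 /vol7.
  have upd u : (fun i0 : 'I_(3 + 4) => match fintype.split i0 with
      inl j => [eta x with i |-> u] j | inr j => w j end)
    = [eta (fun i0 : 'I_(3 + 4) => match fintype.split i0 with
      inl j => x j | inr j => w j end) with lshift 4 i |-> u].
    apply/funext => l; rewrite /= -[l]splitK; case: (fintype.split l) => j /=.
      by rewrite (unsplitK (inl j)); congr (if _ then _ else _).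
    rewrite (unsplitK (inr j)) ifF //; exact: (eq_rlshift j i).
  by rewrite !upd (alternating_slot_lin vP).
apply: (vP.2 _ (lshift 4 i) (lshift 4 j)).
  by rewrite (inj_eq (@lshift_inj 3 4)).
by rewrite (unsplitK (inl i)) (unsplitK (inl j)).
Qed.

Definition Evec (i : nat) : E8 := delta_mx 0 (inord i).

Lemma star7_emono a b c (w : 'I_4 -> E8) :
    (a < 7)%N -> (b < 7)%N -> (c < 7)%N ->
  star7 (emono [tuple a.+1; b.+1; c.+1]) w
  = contract7 w (tnth [tuple Evec a.+1; Evec b.+1; Evec c.+1]).
Proof.
move=> a7 b7 c7; pose t := tnth [tuple Ordinal a7; Ordinal b7; Ordinal c7].
pose e (i : 'I_7) : E8 := delta_mx 0 (lift ord0 i).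
rewrite /star7; transitivity ((3`!)%:R^-1 *
   \sum_(f : {ffun 'I_3 -> 'I_7})
     \det (\matrix_(i, j) (f j == t i)%:R) * contract7 w (e \o f)).
  congr (_ * _); apply: eq_bigr => f _ /=; congr (_ * _).
  rewrite /emono /wedge_list; congr (\det _); apply/matrixP => i j.
  rewrite !mxE tnth_map /coordf !mxE eqxx /=; congr (_%:R).
  rewrite eq_sym -!val_eqE /= /bump leq0n add1n.
  case: i => [[|[|[|//]]] i3]; rewrite /t ?(tnth_nth 0%N) ?(tnth_nth (Ordinal a7)) /=;
    by rewrite inordK.
rewrite (sum_det_delta (alternating_contract7 w)) mulKf //; congr contract7.
apply/funext => -[[|[|[|//]]] i3]; rewrite /t /= !(tnth_nth 0) /=;
  congr delta_mx; apply: val_inj; rewrite /= ?inordK //.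
Qed.

Lemma coordf_Evec i j : (i < 8)%N -> (j < 8)%N ->
  coordf i (Evec j : E8) = (i == j)%:R.
Proof.
by move=> i8 j8; rewrite /coordf !mxE eqxx /= -val_eqE /= !inordK.
Qed.

(** The star of a monomial is, up to sign, the monomial in the four other
    coordinates. It is the minor left by expanding a 7 x 7 determinant along
    three columns that are basis vectors. Here a, r and s are the rows of their
    nonzero entries, each counted among the rows still present: r and s differ
    from b and c by the rows already deleted. Coordinates 1, ..., 7 are the rows
    0, ..., 6. *)
Lemma star7_block a b c r s (t : 4.-tuple nat) (w : 'I_4 -> E8) :
    [&& (a < 7)%N, (b < 7)%N, (c < 7)%N, (r < 6)%N & (s < 5)%N] ->
    all (fun i => (bump a i == b) == (i == r)) (iota 0 6) ->
    all (fun i => (bump a (bump r i) == c) == (i == s)) (iota 0 5) ->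
    tval t = [seq (bump a (bump r (bump s i))).+1 | i <- iota 0 4] ->
  star7 (emono [tuple a.+1; b.+1; c.+1]) w = (-1) ^+ (a + r + s) * emono t w.
Proof.
case/and5P=> a7 b7 c7 r6 s5 /allP hr /allP hs ht.
rewrite star7_emono //.
pose x := [:: Evec a.+1; Evec b.+1; Evec c.+1;
              w (inord 0); w (inord 1); w (inord 2); w (inord 3) : E8].
have -> : contract7 w (tnth [tuple Evec a.+1; Evec b.+1; Evec c.+1])
    = ndet 7 (fun i j => coordf i.+1 (nth 0 x j)).
  rewrite /contract7 /vol7 /emono /wedge_list; congr (\det _).
  apply/matrixP => i j; rewrite !mxE tnth_map (tnth_nth 0%N).
  congr (coordf _ _).
    by case: i => [[|[|[|[|[|[|[|//]]]]]]] i7].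
  rewrite -[j](@splitK 3 4); case: (@fintype.split 3 4 j) => k;
    rewrite ?(unsplitK (inl k)) ?(unsplitK (inr k)).
    by rewrite (tnth_nth 0); case: k => [[|[|[|//]]] k3].
  rewrite {1}[w]tuple4E (tnth_nth 0).
  by case: k => [[|[|[|[|//]]]] k4].
have lt_bump h i n : (i < n)%N -> (bump h i < n.+1)%N.
  by move=> i_n; rewrite /bump; case: (h <= i)%N; rewrite ?add1n ?add0n ?ltnS // ltnW.
rewrite (@ndet_delta _ 6 _ a) // => [|i i7]; last by rewrite coordf_Evec // eqSS.
rewrite (@ndet_delta _ 5 _ r) // => [|i i6]; last first.
  have i7 : (bump a i < 7)%N by exact: lt_bump.
  rewrite coordf_Evec // eqSS.
  by have /eqP-> : (bump a i == b) == (i == r) by apply: hr; rewrite mem_iota.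
rewrite (@ndet_delta _ 4 _ s) // => [|i i5]; last first.
  have i7 : (bump a (bump r i) < 7)%N by apply/lt_bump/lt_bump.
  rewrite coordf_Evec // eqSS.
  by have /eqP-> : (bump a (bump r i) == c) == (i == s) by apply: hs; rewrite mem_iota.
rewrite !exprD !mulrA; congr (_ * _).
rewrite /emono /wedge_list; congr (\det _).
apply/matrixP => i j; rewrite !mxE tnth_map (tnth_nth 0%N) ht.
rewrite (nth_map 0%N) ?size_iota // nth_iota // add0n; congr coordf.
rewrite [w in RHS]tuple4E (tnth_nth 0).
by case: j => [[|[|[|[|//]]]] j4].
Qed.

Definition associative_blocks : seq (int * 3.-tuple nat) :=
  [:: (1%R, [tuple 1; 2; 3]); ((-1)%R, [tuple 1; 4; 5]); ((-1)%R, [tuple 1; 6; 7]);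
      ((-1)%R, [tuple 2; 4; 6]); (1%R, [tuple 2; 5; 7]);
      ((-1)%R, [tuple 3; 4; 7]); ((-1)%R, [tuple 3; 5; 6])]%N.

Definition cayley_blocks : seq (int * 4.-tuple nat) :=
  [:: (1%R, [tuple 0; 1; 2; 3]); ((-1)%R, [tuple 0; 1; 4; 5]);
      ((-1)%R, [tuple 0; 1; 6; 7]); ((-1)%R, [tuple 0; 2; 4; 6]);
      (1%R, [tuple 0; 2; 5; 7]); ((-1)%R, [tuple 0; 3; 4; 7]);
      ((-1)%R, [tuple 0; 3; 5; 6]); (1%R, [tuple 4; 5; 6; 7]);
      ((-1)%R, [tuple 2; 3; 6; 7]); ((-1)%R, [tuple 2; 3; 4; 5]);
      ((-1)%R, [tuple 1; 3; 5; 7]); (1%R, [tuple 1; 3; 4; 6]);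
      ((-1)%R, [tuple 1; 2; 5; 6]); ((-1)%R, [tuple 1; 2; 4; 7])]%N.

Lemma emono3E a b c (v : 'I_3 -> E8) :
  emono [tuple a; b; c] v
  = ndet 3 (fun i j => coordf (nth 0%N [:: a; b; c] i) (v (inord j))).
Proof.
rewrite /emono /wedge_list; congr (\det _); apply/matrixP => i j.
rewrite !mxE tnth_map (tnth_nth 0%N) /=; congr (coordf _ (v _)).
by apply: val_inj; rewrite /= inordK.
Qed.

Lemma phi0_blocks (v : 'I_3 -> E8) :
  phi0 v = \sum_(b <- associative_blocks) b.1%:~R * emono b.2 v.
Proof.
rewrite phi0E /associative_blocks !big_cons big_nil /=.
have -> : emono [tuple 2; 7; 5]%N v = - emono [tuple 2; 5; 7]%N v.
  by rewrite !emono3E !ndet3 /=; ring.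
by ring.
Qed.

Lemma star7_sum I (r : seq I) (c : I -> R) (F : I -> kform R E8 3) w :
  star7 (fun v => \sum_(i <- r) c i * F i v) w = \sum_(i <- r) c i * star7 (F i) w.
Proof.
rewrite /star7; under eq_bigr => f _ do rewrite mulr_suml.
rewrite exchange_big mulr_sumr; apply: eq_bigr => i _.
rewrite mulrCA !mulr_sumr; apply: eq_bigr => f _; ring.
Qed.

(** The associative form has seven blocks; each one gives a block of the Cayley
    form by adjoining the index 0 and another by complementation. *)
Lemma Phi0_blocks (v : 'I_4 -> E8) :
  Phi0 v = \sum_(b <- cayley_blocks) b.1%:~R * emono b.2 v.
Proof.
have phi0E' : @phi0 R = fun v => \sum_(b <- associative_blocks) b.1%:~R * emono b.2 v.
  by apply/funext => x; exact: phi0_blocks.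
have phi0P : alternating_form (@phi0 R).
  rewrite phi0E'; apply: alternating_sum => b; apply: alternating_scale.
  exact: alternating_emono.
have -> : Phi0 v = \sum_(b <- associative_blocks)
    b.1%:~R * (emono [tuple of 0%N :: b.2] v + star7 (emono b.2) v).
  rewrite /Phi0 wedge_emono1 // phi0E' star7_sum.
  under [RHS]eq_bigr => b _ do rewrite mulrDr.
  rewrite big_split; congr (_ + _).
  transitivity (\sum_(i < 4) \sum_(b <- associative_blocks)
      (-1) ^+ i * coordf 0 (v i) * (b.1%:~R * emono b.2 (v \o lift i))).
    by apply: eq_bigr => i _; rewrite mulr_sumr.
  rewrite exchange_big; apply: eq_bigr => b _.
  rewrite emono_cons mulr_sumr; apply: eq_bigr => i _ /=; ring.
have cons0 a b c : [tuple of 0%N :: [tuple a; b; c]] = [tuple 0%N; a; b; c].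
  exact: val_inj.
rewrite /associative_blocks /cayley_blocks !big_cons !big_nil [LHS]/= [RHS]/= !cons0.
rewrite (@star7_block 0 1 2 0 0 [tuple 4; 5; 6; 7]%N) //.
rewrite (@star7_block 0 3 4 2 2 [tuple 2; 3; 6; 7]%N) //.
rewrite (@star7_block 0 5 6 4 4 [tuple 2; 3; 4; 5]%N) //.
rewrite (@star7_block 1 3 5 2 3 [tuple 1; 3; 5; 7]%N) //.
rewrite (@star7_block 1 4 6 3 4 [tuple 1; 3; 4; 6]%N) //.
rewrite (@star7_block 2 3 6 2 4 [tuple 1; 2; 5; 6]%N) //.
rewrite (@star7_block 2 4 5 3 3 [tuple 1; 2; 4; 7]%N) //.
rewrite !addnE /=.
by ring.
Qed.

Lemma alternating_Phi0 : alternating_form (@Phi0 R).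
Proof.
rewrite (_ : @Phi0 R = fun v => \sum_(b <- cayley_blocks) b.1%:~R * emono b.2 v).
  apply: alternating_sum => b; apply: alternating_scale.
  exact: alternating_emono.
by apply/funext => x; exact: Phi0_blocks.
Qed.

End Cayley.

(** * The cross product identity *)

(** The right-hand side of the identity for g (P(x,y,z), P(a,b,c)): the Gram
    determinant of the two triples, corrected by the nine terms
    g(x_i, a_j) Phi(x_(i+1), x_(i+2), a_(j+1), a_(j+2)), indices mod 3. *)
Definition cross_gram (S : comNzRingType) (X : Type)
    (ph : X -> X -> X -> X -> S) (d : X -> X -> S) (x y z a b c : X) : S :=
  (d x a * (d y b * d z c - d y c * d z b)
     - d x b * (d y a * d z c - d y c * d z a)
     + d x c * (d y a * d z b - d y b * d z a))
  + (d x a * ph y z b c + d x b * ph y z c a + d x c * ph y z a b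
     + d y a * ph z x b c + d y b * ph z x c a + d y c * ph z x a b
     + d z a * ph x y b c + d z b * ph x y c a + d z c * ph x y a b).

(** Generic in the ring and in the type of vectors, so that the same expression
    can be read over the reals, on vectors, and over the integers, on indices
    of basis vectors. The sum over l is g (P(x,y,z), P(a,b,c)) in the
    orthonormal basis e. *)
Definition cross_defect (S : comNzRingType) (X : Type)
    (ph : X -> X -> X -> X -> S) (d : X -> X -> S) (e : nat -> X)
    (x y z a b c : X) : S :=
  foldr (fun l acc => ph x y z (e l) * ph a b c (e l) + acc) 0 (iota 0 8)
  - cross_gram ph d x y z a b c.

Local Arguments bdet : simpl never.

Definition cayley_coef (i j k l : nat) : int :=
  foldr (fun (b : int * 4.-tuple nat) acc => b.1 * bdet 4 (fun r s =>
    nth 0%N b.2 r == nth 0%N [:: i; j; k; l] s) + acc) 0 cayley_blocks.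

Definition kron (i j : nat) : int := (i == j)%N.

(* Tabulating the 8^4 structure constants once keeps the evaluation below
   cheap. *)
Definition lookup4 (t : seq (seq (seq (seq int)))) i j k l : int :=
  nth 0 (nth [::] (nth [::] (nth [::] t i) j) k) l.

Definition table4 (c : nat -> nat -> nat -> nat -> int) :=
  mkseq (fun i => mkseq (fun j => mkseq (fun k => mkseq (c i j k) 8) 8) 8) 8.

Definition all_increasing3 (p : nat -> nat -> nat -> bool) :=
  all (fun i => all (fun j => all (p i j) (iota j.+1 (7 - j))) (iota i.+1 (7 - i)))
    (iota 0 8).

(** The finite verification behind the identity: 56 increasing triples on each
    side. *)
Lemma cross_defect_coef0 :
  let t := table4 cayley_coef in
  all_increasing3 (fun i j k => all_increasing3 (fun a b c =>
    cross_defect (lookup4 t) kron id i j k a b c == 0)).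
Proof. by vm_compute. Qed.

Lemma all_increasing3P p : all_increasing3 p ->
  forall i j k, (i < j)%N -> (j < k)%N -> (k < 8)%N -> p i j k.
Proof.
move=> /allP h i j k ij jk k8.
have j8 := ltn_trans jk k8; have i8 := ltn_trans ij j8.
have := h i; rewrite mem_iota => /(_ i8) /allP /(_ j).
rewrite mem_iota ij /= addSn subnKC // => /(_ j8) /allP /(_ k).
by rewrite mem_iota jk /= addSn subnKC //; apply.
Qed.

(** The defect is multilinear, alternating in (x,y,z), and symmetric under the
    exchange of the two triples, hence alternating in (a,b,c) as well. This uses
    only that Phi is alternating and that g is symmetric and bilinear. *)
Section CrossDefect.
Variables (R : realType) (E : lmodType R).
Variables (ph : E -> E -> E -> E -> R) (d : E -> E -> R) (e : nat -> E).
Hypothesis ph_lin : forall y z w, scalar (fun x => ph x y z w).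
Hypothesis phC12 : forall x y z w, ph y x z w = - ph x y z w.
Hypothesis phC23 : forall x y z w, ph x z y w = - ph x y z w.
Hypothesis phC34 : forall x y z w, ph x y w z = - ph x y z w.
Hypothesis d_lin : forall y, scalar (fun x => d x y).
Hypothesis dC : forall x y, d x y = d y x.
Let D := cross_defect ph d e.

Lemma cross_defectC x y z a b c : D x y z a b c = D a b c x y z.
Proof.
have P u v w t : ph u v w t = ph w t u v.
  by rewrite phC23 phC12 phC34 phC23; ring.
rewrite /D /cross_defect /cross_gram /= ![d a _]dC ![d b _]dC ![d c _]dC.
by rewrite ![ph b c _ _]P ![ph c a _ _]P ![ph a b _ _]P; ring.
Qed.

Lemma alternating_cross_defect a b c :
  alternating_form (fun v : 'I_3 -> E =>
    D (v (inord 0)) (v (inord 1)) (v (inord 2)) a b c).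
Proof.
have ph_lin2 x z w : scalar (fun y => ph x y z w).
  by move=> r y y'; rewrite phC12 ph_lin !(phC12 _ x) /=; ring.
apply: (alternating_form3 (f := fun x y z => D x y z a b c)) => [y z|x y z|x y z].
- by move=> r x x'; rewrite /D /cross_defect /cross_gram /= !d_lin !ph_lin !ph_lin2; ring.
- by rewrite /D /cross_defect /cross_gram /= !(phC12 x y) !(phC12 x z) !(phC12 y z); ring.
- rewrite /D /cross_defect /cross_gram /= !(phC23 _ y z).
  by rewrite !(phC12 x y) !(phC12 x z) !(phC12 y z); ring.
Qed.

End CrossDefect.

Section CrossIdentity.
Context {R : realType}.
Local Notation E8 := 'rV[R]_8.

Definition Phi4 (x y z w : E8) : R := Phi0 (tnth [tuple x; y; z; w]).

Lemma Phi4C12 x y z w : Phi4 y x z w = - Phi4 x y z w.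
Proof. exact: (curry4C12 alternating_Phi0). Qed.
Lemma Phi4C23 x y z w : Phi4 x z y w = - Phi4 x y z w.
Proof. exact: (curry4C23 alternating_Phi0). Qed.
Lemma Phi4C34 x y z w : Phi4 x y w z = - Phi4 x y z w.
Proof. exact: (curry4C34 alternating_Phi0). Qed.
Lemma Phi4lin1 y z w : scalar (fun x => Phi4 x y z w).
Proof. exact: (curry4lin alternating_Phi0). Qed.
Lemma Phi4lin2 x z w : scalar (fun y => Phi4 x y z w).
Proof. by move=> c y y'; rewrite Phi4C12 Phi4lin1 !(Phi4C12 _ x) /=; ring. Qed.
Lemma Phi4lin3 x y w : scalar (fun z => Phi4 x y z w).
Proof. by move=> c z z'; rewrite Phi4C23 Phi4lin2 !(Phi4C23 _ y) /=; ring. Qed.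
Lemma Phi4lin4 x y z : scalar (fun w => Phi4 x y z w).
Proof. by move=> c w w'; rewrite Phi4C34 Phi4lin3 !(Phi4C34 _ _ z) /=; ring. Qed.

Lemma g0_lin (y : E8) : scalar (fun x => g0 x y).
Proof.
move=> c x x'; rewrite /g0 mulr_sumr -big_split; apply: eq_bigr => i _ /=.
by rewrite !mxE mulrDl mulrA.
Qed.

Lemma g0C (x y : E8) : g0 x y = g0 y x.
Proof. by apply: eq_bigr => i _; rewrite mulrC. Qed.

Lemma Phi4_Evec i j k l : (i < 8)%N -> (j < 8)%N -> (k < 8)%N -> (l < 8)%N ->
  Phi4 (Evec i) (Evec j) (Evec k) (Evec l) = (cayley_coef i j k l)%:~R.
Proof.
move=> i8 j8 k8 l8; rewrite /Phi4 Phi0_blocks /cayley_coef.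
have : all (fun b : int * 4.-tuple nat => all (fun a => a < 8)%N b.2) cayley_blocks by [].
elim: cayley_blocks => [|b s IH] /=; first by rewrite big_nil.
case/andP => b8 /IH; rewrite big_cons rmorphD rmorphM /= => <-.
congr (_ * _ + _); rewrite /emono -ndet_bdet /wedge_list; congr (\det _).
apply/matrixP => r u; rewrite !mxE tnth_map (tnth_nth 0%N) (tnth_nth (0 : E8)) /=.
have br : (nth 0%N b.2 r < 8)%N by apply: (allP b8); rewrite mem_nth ?size_tuple.
by case: u => [[|[|[|[|//]]]] u4] /=; rewrite coordf_Evec.
Qed.

Lemma g0_Evec i j : (i < 8)%N -> (j < 8)%N ->
  g0 (Evec i) (Evec j) = (kron i j)%:~R :> R.
Proof.
move=> i8 j8; rewrite /g0 (bigD1 (inord i)) //= big1 => [|l li].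
  by rewrite !mxE !eqxx /= mul1r addr0 -val_eqE /= !inordK.
by rewrite !mxE (negbTE li) andbF mul0r.
Qed.

Lemma lookup_table4 c i j k l : (i < 8)%N -> (j < 8)%N -> (k < 8)%N -> (l < 8)%N ->
  lookup4 (table4 c) i j k l = c i j k l.
Proof. by move=> i8 j8 k8 l8; rewrite /lookup4 /table4 !nth_mkseq. Qed.

Let D := cross_defect Phi4 (@g0 R) Evec.

Lemma cross_defect_Evec i j k a b c :
    (i < 8)%N -> (j < 8)%N -> (k < 8)%N -> (a < 8)%N -> (b < 8)%N -> (c < 8)%N ->
  D (Evec i) (Evec j) (Evec k) (Evec a) (Evec b) (Evec c)
  = (cross_defect (lookup4 (table4 cayley_coef)) kron id i j k a b c)%:~R.
Proof.
move=> i8 j8 k8 a8 b8 c8; rewrite /D /cross_defect /cross_gram [foldr]lock /= -lock.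
rewrite !(rmorphB, rmorphD, rmorphM) /=.
by rewrite !Phi4_Evec // !g0_Evec // !lookup_table4.
Qed.

Lemma Evec_span (x : E8) : exists c : 'I_8 -> R, x = \sum_i c i *: Evec i.
Proof.
exists (fun i => x 0 i); rewrite {1}[x]row_sum_delta.
by apply: eq_bigr => i _; rewrite /Evec inord_val.
Qed.

(** Alternation reduces first (x,y,z) and then (a,b,c) to increasing triples of
    basis vectors. *)
Lemma cross_identity x y z a b c : D x y z a b c = 0.
Proof.
pose v := tnth [tuple x; y; z]; pose w := tnth [tuple a; b; c].
pose F (v w : 'I_3 -> E8) := D (v (inord 0)) (v (inord 1)) (v (inord 2))
  (w (inord 0)) (w (inord 1)) (w (inord 2)).
have <- : F v w = D x y z a b c.
  by rewrite /F /v /w !(tnth_nth 0) /= !inordK.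
have altD := alternating_cross_defect Evec Phi4lin1 Phi4C12 Phi4C23 g0_lin.
have ltf (f : 'I_3 -> 'I_8) : {homo f : i j / (i < j)%N} ->
    (f (inord 0) < f (inord 1))%N /\ (f (inord 1) < f (inord 2))%N.
  by move=> finc; split; apply: finc; rewrite !inordK.
apply: (alternating_eq0 (e := fun i : 'I_8 => Evec i)
  (altD _ _ _) Evec_span) => f /ltf[f01 f12].
rewrite /F /D cross_defectC //;
  [|exact: Phi4C12|exact: Phi4C23|exact: Phi4C34|exact: g0C].
apply: (alternating_eq0 (e := fun i : 'I_8 => Evec i)
  (altD _ _ _) Evec_span) => h /ltf[h01 h12].
rewrite -/D /= cross_defect_Evec //.
have /= := cross_defect_coef0.
move=> /all_increasing3P /(_ _ _ _ h01 h12 (ltn_ord _)).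
by move=> /all_increasing3P /(_ _ _ _ f01 f12 (ltn_ord _)) /eqP ->.
Qed.

End CrossIdentity.

(** * Four isotropic vectors *)

Lemma wedge4E (R : realType) (E : lmodType R) (f0 f1 f2 f3 : E -> R) x y z w :
  let m a b c :=
    f1 a * (f2 b * f3 c - f2 c * f3 b) - f1 b * (f2 a * f3 c - f2 c * f3 a)
    + f1 c * (f2 a * f3 b - f2 b * f3 a) in
  wedge_list [tuple f0; f1; f2; f3] (tnth [tuple x; y; z; w])
  = f0 x * m y z w - f0 y * m x z w + f0 z * m x y w - f0 w * m x y z.
Proof.
rewrite /= (wedge_listE _ _ f0 0) ndet_recl !big_ord_recl big_ord0 !ndet3 /bump /=.
by ring.
Qed.

Lemma cycE : (1 %% 4 = 1)%N * (2 %% 4 = 2)%N * (3 %% 4 = 3)%N * (4 %% 4 = 0)%N.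
Proof. by []. Qed.

(** An alternating four-form and a metric linked by a cross product whose inner
    products are given by [cross_gram], with four vectors U_i on which the form
    vanishes, and covectors dual to them that vanish on their orthogonal
    complement. The indices 0, ..., 3 are natural numbers, and [cyc] is the
    cyclic successor. *)
Section Toric.
Variable R : realType.
Local Notation E := 'rV[R]_8.
Variables (Phi : E -> E -> E -> E -> R) (g : E -> E -> R) (cross : E -> E -> E -> E).
Hypothesis Phi_lin : forall y z w, scalar (fun x => Phi x y z w).
Hypothesis PhiC12 : forall x y z w, Phi y x z w = - Phi x y z w.
Hypothesis PhiC23 : forall x y z w, Phi x z y w = - Phi x y z w.
Hypothesis PhiC34 : forall x y z w, Phi x y w z = - Phi x y z w.
Hypothesis g_lin : forall y, scalar (fun x => g x y).
Hypothesis gC : forall x y, g x y = g y x.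
Hypothesis g_pos : forall x, x != 0 -> 0 < g x x.
Hypothesis g_cross : forall x y z w, Phi x y z w = g (cross x y z) w.
Hypothesis cross_id : forall x y z a b c,
  g (cross x y z) (cross a b c) = cross_gram Phi g x y z a b c.

Local Notation cyc i := (i.+1 %% 4)%N.
Local Notation cyc2 i := (cyc (cyc i)).
Local Notation cyc3 i := (cyc (cyc (cyc i))).

Variables (U : nat -> E) (theta : nat -> E -> R).
Hypothesis U_isotropic : forall a b c e, Phi (U a) (U b) (U c) (U e) = 0.
Hypothesis theta_lin : forall i, scalar (theta i).
Hypothesis thetaU : forall i j, (i < 4)%N -> (j < 4)%N -> theta i (U j) = (i == j)%:R.
Hypothesis theta_perp : forall i x, (forall j, (j < 4)%N -> g x (U j) = 0) ->
  theta i x = 0.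

(** [dnu_of i] is the covector dnu_i, and [Xvec i] the vector X_i with
    g(X_i, .) = dnu_i. *)
Definition dnu_of i x := (-1) ^+ i * Phi (U (cyc i)) (U (cyc2 i)) (U (cyc3 i)) x.
Definition Xvec i : E := (-1) ^+ i *: cross (U (cyc i)) (U (cyc2 i)) (U (cyc3 i)).
Definition gram i j := g (U i) (U j).
Definition Xgram i j := g (Xvec i) (Xvec j).
Definition gram_mx : 'M[R]_4 := \matrix_(i, j) gram i j.

Let Phi_lin2 x z w : scalar (fun y => Phi x y z w).
Proof. by move=> r y y'; rewrite PhiC12 Phi_lin !(PhiC12 _ x) /=; ring. Qed.
Let Phi_lin3 x y w : scalar (fun z => Phi x y z w).
Proof. by move=> r z z'; rewrite PhiC23 Phi_lin2 !(PhiC23 _ y) /=; ring. Qed.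
Let Phi_lin4 x y z : scalar (fun w => Phi x y z w).
Proof. by move=> r w w'; rewrite PhiC34 Phi_lin3 !(PhiC34 _ _ z) /=; ring. Qed.
Let PhiZ4 x y z r w : Phi x y z (r *: w) = r * Phi x y z w.
Proof.
have p0 : Phi x y z 0 = 0.
  by have := Phi_lin4 x y z (-1) 0 0; rewrite scaler0 addr0 mulN1r addNr.
by rewrite -[r *: w]addr0 Phi_lin4 p0 addr0.
Qed.
Let gZ r x y : g (r *: x) y = r * g x y.
Proof.
have d0 : g 0 y = 0.
  by have := g_lin y (-1) 0 0; rewrite scaler0 addr0 mulN1r addNr.
by rewrite -[r *: x]addr0 g_lin d0 addr0.
Qed.

Let Phi_repeat12 x z w : Phi x x z w = 0.
Proof. by apply/eqP; rewrite -[_ == _]eqNr -PhiC12. Qed.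
Let Phi_repeat23 x z w : Phi z x x w = 0.
Proof. by apply/eqP; rewrite -[_ == _]eqNr -PhiC23. Qed.

Lemma g_Xvec i x : g (Xvec i) x = dnu_of i x.
Proof. by rewrite gZ -g_cross. Qed.

Lemma dnu_of_U i j : dnu_of i (U j) = 0.
Proof. by rewrite /dnu_of U_isotropic mulr0. Qed.

Lemma dnu_of_X i j : dnu_of i (Xvec j) = Xgram i j.
Proof. by rewrite /Xgram g_Xvec. Qed.

Lemma g_Xvec_U i j : g (Xvec i) (U j) = 0.
Proof. by rewrite g_Xvec dnu_of_U. Qed.

Lemma theta_Xvec i j : theta i (Xvec j) = 0.
Proof. by apply: theta_perp => k _; exact: g_Xvec_U. Qed.

Lemma gramC i j : gram i j = gram j i. Proof. exact: gC. Qed.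

(** A vector of the kernel of the Gram matrix gives a combination of the U_i
    orthogonal to all of them, hence zero; the dual covectors read off its
    coefficients. *)
Lemma gram_unit : gram_mx \in unitmx.
Proof.
rewrite unitmxE unitfE; apply/det0P => -[v v0 vB].
pose x : E := \sum_(i < 4) v 0 i *: U i.
have dx j : g x (U (j : 'I_4)) = 0.
  move/rowP/(_ j): vB; rewrite !mxE => <-.
  rewrite (scalar_sum (g_lin _)); apply: eq_bigr => i _.
  by rewrite !mxE.
have x0 : x = 0.
  apply/eqP/negPn/negP => /g_pos.
  suff -> : g x x = 0 by rewrite ltxx.
  rewrite {1}/x (scalar_sum (g_lin _)) big1 // => i _.
  by rewrite gC dx mulr0.
case/eqP: v0; apply/rowP => i; rewrite mxE.
have := scalar_sum (theta_lin i) (fun i => v 0 i) (fun i : 'I_4 => U i).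
rewrite -/x x0 (bigD1 i) //= big1 => [|j ji]; last first.
  by rewrite thetaU // eq_sym val_eqE (negbTE ji) mulr0.
rewrite thetaU // eqxx mulr1 addr0 => <-.
by apply: theta_perp => j _; rewrite -[0](scale0r (0 : E)) gZ mul0r.
Qed.

Local Notation Delta := (\det gram_mx).

(** In the cross product identity for two triples of U's each correction term
    has a factor Phi(U,U,U,U) = 0, and the Gram determinant left is a minor of
    B. *)
Lemma Xgram_adj i j : (i < 4)%N -> (j < 4)%N ->
  Xgram i j = (-1) ^+ (j + i) * ndet 3 (fun r s => gram (bump j r) (bump i s)).
Proof.
move=> i4 j4; rewrite /Xgram gZ gC gZ cross_id /cross_gram
  !U_isotropic -!/(gram _ _) ndet3.
move: i i4 j j4 => [|[|[|[|//]]]] _ [|[|[|[|//]]]] _;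
  rewrite /bump /= ?(gramC 1 0) ?(gramC 2 0) ?(gramC 3 0) ?(gramC 2 1) ?(gramC 3 1)
    ?(gramC 3 2);
  by ring.
Qed.

Lemma gram_mul_Xgram i m : (i < 4)%N -> (m < 4)%N ->
  \sum_(k < 4) gram i k * Xgram k m = Delta * (i == m)%:R.
Proof.
move=> i4 m4; have := mul_mx_adj gram_mx.
move/matrixP => /(_ (Ordinal i4) (Ordinal m4)).
rewrite [RHS]mxE -val_eqE mxE mulr_natr => <-; apply: eq_bigr => k _.
by rewrite [gram_mx _ _]mxE Xgram_adj //; congr (_ * _); rewrite (adj_ndet gram).
Qed.

(** This is adj(adj(B)) = det(B)^2 B: the matrix C of the g(X_i, X_j) is
    det(B) B^-1, so det(C) = det(B)^3 and adj(C) = det(C) C^-1. *)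
Lemma Xgram_minor i j : (i < 4)%N -> (j < 4)%N ->
  (-1) ^+ (j + i) * ndet 3 (fun r s => Xgram (bump j r) (bump i s))
  = Delta ^+ 2 * gram i j.
Proof.
move=> i4 j4; have Bu := gram_unit.
pose C : 'M[R]_4 := \matrix_(r, s) Xgram r s.
have D0 : Delta != 0 by rewrite -unitfE -unitmxE.
have CE : C = Delta *: invmx gram_mx.
  rewrite /invmx Bu scalerA divff // scale1r; apply/matrixP => r s.
  by rewrite /C /gram_mx (adj_ndet gram) mxE Xgram_adj.
have detC : \det C = Delta ^+ 3.
  by rewrite CE detZ det_inv exprS mulrAC divff // mul1r.
have Cu : C \in unitmx by rewrite unitmxE unitfE detC expf_neq0.
have CB : C *m gram_mx = Delta%:M.
  by rewrite CE -scalemxAl mulVmx // scalemx1.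
have : Delta *: \adj C = Delta ^+ 3 *: gram_mx.
  by rewrite -mul_mx_scalar -CB mulmxA mul_adj_mx detC mul_scalar_mx.
rewrite exprS -scalerA => /(scalerI D0)/matrixP/(_ (Ordinal i4) (Ordinal j4)).
by rewrite (adj_ndet Xgram) !mxE.
Qed.

(* Rewriting with these two families sorts the first three arguments of
   Phi(U_a, U_b, U_c, z). *)
Let sort12 := (PhiC12 (U 0) (U 1), PhiC12 (U 0) (U 2), PhiC12 (U 0) (U 3),
  PhiC12 (U 1) (U 2), PhiC12 (U 1) (U 3), PhiC12 (U 2) (U 3), Phi_repeat12, Phi_repeat23).
Let sort23 x z := (PhiC23 x (U 0) (U 1) z, PhiC23 x (U 0) (U 2) z,
  PhiC23 x (U 0) (U 3) z, PhiC23 x (U 1) (U 2) z, PhiC23 x (U 1) (U 3) z,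
  PhiC23 x (U 2) (U 3) z).

Lemma Phi_U012 z : Phi (U 0) (U 1) (U 2) z = - dnu_of 3 z.
Proof. by rewrite /dnu_of /=; ring. Qed.
Lemma Phi_U013 z : Phi (U 0) (U 1) (U 3) z = dnu_of 2 z.
Proof. by rewrite /dnu_of /= !(sort12, sort23); ring. Qed.
Lemma Phi_U023 z : Phi (U 0) (U 2) (U 3) z = - dnu_of 1 z.
Proof. by rewrite /dnu_of /= !(sort12, sort23); ring. Qed.
Lemma Phi_U123 z : Phi (U 1) (U 2) (U 3) z = dnu_of 0 z.
Proof. by rewrite /dnu_of /=; ring. Qed.

(** The way in for the cross product identity, whenever the last argument is one
    of the X's. *)
Lemma Phi_Xvec x y z m : Phi x y z (Xvec m)
  = (-1) ^+ m * g (cross x y z) (cross (U (cyc m)) (U (cyc2 m)) (U (cyc3 m))).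
Proof. by rewrite PhiZ4 g_cross. Qed.

Lemma Phi_pairC x y z w : Phi x y z w = Phi z w x y.
Proof. by rewrite PhiC23 PhiC12 PhiC34 PhiC23; ring. Qed.

(** Only the correction terms with one g(U,U) and three U's in Phi survive; they
    are products B_an C_ki, and for each choice of a, b, m they recombine by
    B C = det(B). *)
Lemma Phi_UUXX a b i m : (a < 4)%N -> (b < 4)%N -> (i < 4)%N -> (m < 4)%N ->
  Phi (U a) (U b) (Xvec i) (Xvec m)
  = (a == m)%:R * (Delta * (b == i)%:R) - (b == m)%:R * (Delta * (a == i)%:R).
Proof.
move=> a4 b4 i4 m4; rewrite -!gram_mul_Xgram // Phi_Xvec cross_id /cross_gram
  !U_isotropic !g_Xvec_U.
have mv k l : Phi (Xvec i) (U a) (U k) (U l) = - Phi (U a) (U k) (U l) (Xvec i).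
  by rewrite PhiC12 PhiC23 PhiC34; ring.
have mv' k l : Phi (U b) (Xvec i) (U k) (U l) = Phi (U b) (U k) (U l) (Xvec i).
  by rewrite PhiC23 PhiC34; ring.
rewrite !mv !mv' -!/(gram _ _).
move: a b m a4 b4 m4 {mv mv'} => [|[|[|[|//]]]] [|[|[|[|//]]]] [|[|[|[|//]]]] _ _ _;
  rewrite /= !big_ord_recl !big_ord0 /bump /= ?(sort12, sort23);
  rewrite ?(Phi_U012, Phi_U013, Phi_U023, Phi_U123) ?dnu_of_X;
  rewrite ?(gramC 1 0) ?(gramC 2 0) ?(gramC 3 0) ?(gramC 2 1) ?(gramC 3 1)
    ?(gramC 3 2) /=.
all: ring.
Qed.

Lemma Phi_UXXX a l : (a < 4)%N -> (l < 4)%N ->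
  Phi (U a) (Xvec (bump l 0)) (Xvec (bump l 1)) (Xvec (bump l 2))
  = (-1) ^+ l * (Delta * gram a l).
Proof.
move=> a4 l4; rewrite Phi_Xvec cross_id /cross_gram !g_Xvec_U.
rewrite !(Phi_pairC (Xvec _)) !(mul0r, mulr0, addr0, add0r, subr0).
by case: l l4 => [|[|[|[|//]]]] _;
  rewrite /bump /= cycE !Phi_UUXX // -!/(gram _ _) /=; ring.
Qed.

Lemma Phi_XXXX : Phi (Xvec 0) (Xvec 1) (Xvec 2) (Xvec 3) = 0.
Proof. by rewrite Phi_Xvec cross_id /cross_gram !g_Xvec_U; ring. Qed.

(** The two-form dnu^t adj(V) theta, written with adj(V) = det(B)^-1 B. *)
Definition omega : kform R E 2 := fun v =>
  \sum_(i < 4) \sum_(j < 4) (Delta^-1 * gram i j)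
    * wedge_list [tuple dnu_of i; theta j] v.

Lemma omegaE x y : omega (tnth [tuple x; y])
  = \sum_(i < 4) \sum_(j < 4) (Delta^-1 * gram i j)
    * (dnu_of i x * theta j y - dnu_of i y * theta j x).
Proof.
apply: eq_bigr => i _; apply: eq_bigr => j _; congr (_ * _).
by rewrite (wedge_listE _ _ (theta 0) 0) ndet2.
Qed.

Lemma omega_UU a b : omega (tnth [tuple U a; U b]) = 0.
Proof.
rewrite omegaE big1 // => i _; rewrite big1 // => j _; rewrite !dnu_of_U; ring.
Qed.

Lemma omega_XX a b : omega (tnth [tuple Xvec a; Xvec b]) = 0.
Proof.
rewrite omegaE big1 // => i _; rewrite big1 // => j _; rewrite !theta_Xvec; ring.
Qed.

Lemma gram_det_neq0 : Delta != 0.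
Proof. by rewrite -unitfE -unitmxE gram_unit. Qed.

(** The two-form pairs the U's and the X's as dual bases, because adj(V) is the
    inverse of the Gram matrix adj(B) of the X's. *)
Lemma omega_UX a m : (a < 4)%N -> (m < 4)%N ->
  omega (tnth [tuple U a; Xvec m]) = - (a == m)%:R.
Proof.
move=> a4 m4; apply: (mulfI gram_det_neq0); rewrite mulrN -gram_mul_Xgram // omegaE.
rewrite mulr_sumr -sumrN; apply: eq_bigr => i _.
rewrite (bigD1 (Ordinal a4)) //= big1 => [|j ja].
  rewrite dnu_of_U dnu_of_X thetaU // eqxx gramC /=.
  by have D0 := gram_det_neq0; field.
have ja' : (val j == a) = false by exact: negbTE ja.
by rewrite dnu_of_U thetaU // ja' /=; ring.
Qed.

(** The right-hand side of the formula for Phi, with det(V) = det(B)^-1. *)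
Definition toric_form : kform R E 4 := fun v =>
  Delta^-1 * (\sum_(i < 4) (-1) ^+ i *
    wedge_list [tuple theta i; dnu_of (cyc i); dnu_of (cyc2 i); dnu_of (cyc3 i)] v)
  + (\sum_(i < 4) (-1) ^+ (cyc3 i) *
    wedge_list [tuple theta i; theta (cyc i); theta (cyc2 i); dnu_of (cyc3 i)] v)
  + (2 * Delta^-1)^-1 * wedge_form omega omega v.

Lemma dnu_of_lin i : scalar (dnu_of i).
Proof. by move=> r x y; rewrite /dnu_of Phi_lin4 /=; ring. Qed.

Lemma alternating_omega : alternating_form omega.
Proof.
do 2! (apply: alternating_sum => ?); apply: alternating_scale.
apply: alternating_wedge_list => -[[|[|//]] k2];
  rewrite (tnth_nth (theta 0)); [exact: dnu_of_lin|exact: theta_lin].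
Qed.

Lemma alternating_omega_sq : alternating_form (wedge_form omega omega : kform R E 4).
Proof.
have omP := alternating_omega.
have omC x y : omega (tnth [tuple y; x]) = - omega (tnth [tuple x; y]).
  exact: alternating2C.
have oml y : scalar (fun x => omega (tnth [tuple x; y])).
  move=> r x x'; rewrite !omegaE mulr_sumr -big_split; apply: eq_bigr => i _ /=.
  rewrite mulr_sumr -big_split; apply: eq_bigr => j _ /=.
  by rewrite dnu_of_lin theta_lin /=; ring.
rewrite (_ : wedge_form omega omega = fun v : 'I_4 -> E =>
  2 * (omega (tnth [tuple v (inord 0); v (inord 1)])
    * omega (tnth [tuple v (inord 2); v (inord 3)])
         - omega (tnth [tuple v (inord 0); v (inord 2)])
           * omega (tnth [tuple v (inord 1); v (inord 3)])
         + omega (tnth [tuple v (inord 0); v (inord 3)])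
           * omega (tnth [tuple v (inord 1); v (inord 2)]))); last first.
  by apply/funext => v; rewrite {1}[v]tuple4E wedge_form_square2.
apply: (alternating_form4 (f := fun x y z w =>
  2 * (omega (tnth [tuple x; y]) * omega (tnth [tuple z; w])
         - omega (tnth [tuple x; z]) * omega (tnth [tuple y; w])
         + omega (tnth [tuple x; w]) * omega (tnth [tuple y; z]))));
  move: omega omC oml {omP} => o oC oL.
- by move=> y z w r x x'; rewrite !oL /=; ring.
- by move=> x y z w; rewrite (oC x y); ring.
- by move=> x y z w; rewrite (oC y z); ring.
- by move=> x y z w; rewrite (oC z w); ring.
Qed.

Lemma alternating_toric_form : alternating_form toric_form.
Proof.
apply: alternating_add; last exact: alternating_scale alternating_omega_sq.
apply: alternating_add; [apply: alternating_scale|];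
  apply: alternating_sum => i; apply: alternating_scale;
  apply: alternating_wedge_list => -[[|[|[|[|//]]]] k2];
  rewrite (tnth_nth (theta 0)) /=; by [exact: dnu_of_lin|exact: theta_lin].
Qed.

Lemma toric_formE x y z w : toric_form (tnth [tuple x; y; z; w]) =
  Delta^-1 * (\sum_(i < 4) (-1) ^+ i *
    wedge_list [tuple theta i; dnu_of (cyc i); dnu_of (cyc2 i); dnu_of (cyc3 i)]
      (tnth [tuple x; y; z; w]))
  + (\sum_(i < 4) (-1) ^+ (cyc3 i) *
    wedge_list [tuple theta i; theta (cyc i); theta (cyc2 i); dnu_of (cyc3 i)]
      (tnth [tuple x; y; z; w]))
  + Delta * (omega (tnth [tuple x; y]) * omega (tnth [tuple z; w])
         - omega (tnth [tuple x; z]) * omega (tnth [tuple y; w])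
         + omega (tnth [tuple x; w]) * omega (tnth [tuple y; z])).
Proof.
rewrite /toric_form wedge_form_square2; last exact: alternating_omega.
congr (_ + _); rewrite mulrA; congr (_ * _).
by have D0 := gram_det_neq0; field.
Qed.

Let adapted_values := (dnu_of_U, theta_Xvec, omega_UU, omega_XX, mul0r, mulr0, subr0,
  addr0, add0r, oppr0).

Lemma toric_form_UUUU a b c e : toric_form (tnth [tuple U a; U b; U c; U e]) = 0.
Proof.
rewrite toric_formE !adapted_values ?big1 ?mulr0 ?add0r // => i _;
  by rewrite wedge4E !adapted_values.
Qed.

Lemma toric_form_XXXX a b c e :
  toric_form (tnth [tuple Xvec a; Xvec b; Xvec c; Xvec e]) = 0.
Proof.
rewrite toric_formE !adapted_values ?big1 ?mulr0 ?add0r // => i _;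
  by rewrite wedge4E !adapted_values.
Qed.

Lemma toric_form_UUXX a b i m : (a < 4)%N -> (b < 4)%N -> (i < 4)%N -> (m < 4)%N ->
  toric_form (tnth [tuple U a; U b; Xvec i; Xvec m])
  = (a == m)%:R * (Delta * (b == i)%:R) - (b == m)%:R * (Delta * (a == i)%:R).
Proof.
move=> a4 b4 i4 m4; rewrite toric_formE !adapted_values !omega_UX // !big1 => [|l _|l _].
- by rewrite mulr0; ring.
- by rewrite wedge4E !adapted_values.
- by rewrite wedge4E !adapted_values.
Qed.

Lemma toric_form_UUUX l m : (l < 4)%N ->
  toric_form (tnth [tuple U (bump l 0); U (bump l 1); U (bump l 2); Xvec m])
  = (-1) ^+ l * Xgram l m.
Proof.
move=> l4; rewrite toric_formE !adapted_values [X in Delta^-1 * X]big1 => [|i _];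
  last first.
  by rewrite wedge4E !adapted_values.
rewrite mulr0 add0r !big_ord_recl big_ord0 !wedge4E !adapted_values !dnu_of_X.
by case: l l4 => [|[|[|[|//]]]] _; rewrite /bump /= !cycE !thetaU //=; ring.
Qed.

(** The dual form theta_a selects one summand, which is a minor of adj(B). *)
Lemma toric_form_UXXX a l : (a < 4)%N -> (l < 4)%N ->
  toric_form (tnth [tuple U a; Xvec (bump l 0); Xvec (bump l 1); Xvec (bump l 2)])
  = (-1) ^+ l * (Delta * gram a l).
Proof.
move=> a4 l4; rewrite toric_formE !adapted_values [X in _ + X]big1 => [|i _]; last first.
  by rewrite wedge4E !adapted_values.
have -> : Delta * gram a l = Delta^-1 * (Delta ^+ 2 * gram l a).
  by rewrite gramC; have D0 := gram_det_neq0; field.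
rewrite -Xgram_minor // ndet3 addr0 !big_ord_recl big_ord0 !wedge4E !adapted_values
  !dnu_of_X.
by case: l l4 => [|[|[|[|//]]]] _; case: a a4 => [|[|[|[|//]]]] _;
  rewrite /bump /= !cycE !thetaU //=; ring.
Qed.

Definition adapted_frame (k : nat) : E := if (k < 4)%N then U k else Xvec (k - 4).

(** The coefficients of a vanishing combination are detected by the theta_i on
    the U's, and then by the dnu_i on the X's, whose Gram matrix is
    invertible. *)
Lemma adapted_frame_span x : exists c : 'I_8 -> R, x = \sum_i c i *: adapted_frame i.
Proof.
pose M : 'M[R]_8 := \matrix_(i < 8) adapted_frame i.
have ME v : v *m M = \sum_i v 0 i *: adapted_frame i.
  by rewrite mulmx_sum_row; apply: eq_bigr => i _; rewrite rowK.
suff Mu : M \in unitmx.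
  exists (fun i => (x *m invmx M) 0 i); rewrite -ME.
  by rewrite mulmxKV.
rewrite unitmxE unitfE; apply/det0P => -[v v0 vM].
have sumM f : scalar f -> \sum_(i < 4) v 0 (lshift 4 i) * f (U i)
    + \sum_(i < 4) v 0 (rshift 4 i) * f (Xvec i) = 0.
  move=> fP; have f0 : f 0 = 0.
    by have := fP (-1) 0 0; rewrite scaler0 addr0 mulN1r addNr.
  have := scalar_sum fP (fun i => v 0 i) (fun i : 'I_(4 + 4) => adapted_frame i).
  rewrite -ME vM f0 (@big_split_ord _ _ _ 4 4) /= => H.
  rewrite [RHS]H; congr (_ + _).
    by apply: eq_bigr => i _; rewrite /adapted_frame /= ltn_ord.
  by apply: eq_bigr => i _; rewrite /adapted_frame /= addKn.
case/eqP: v0; apply/rowP => i; rewrite mxE -[i](@splitK 4 4).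
case: (@fintype.split 4 4 i) => k /=.
  have := sumM _ (theta_lin k); rewrite addrC big1 => [|j _];
    last by rewrite theta_Xvec mulr0.
  rewrite add0r (bigD1 k) //= thetaU // eqxx mulr1 big1 => [|j jk];
    first by rewrite addr0.
  have jk' : (val k == val j) = false by rewrite eq_sym; exact: negbTE jk.
  by rewrite thetaU // jk' mulr0.
apply: (mulfI gram_det_neq0); rewrite mulr0.
transitivity (\sum_(j < 4) gram k j * (\sum_(l < 4) v 0 (rshift 4 l) * Xgram j l)).
  under [RHS]eq_bigr => j _ do rewrite mulr_sumr.
  rewrite exchange_big (bigD1 k) //= [X in _ + X]big1 ?addr0 => [|l lk].
    under eq_bigr => j _ do rewrite mulrCA.
    by rewrite -mulr_sumr gram_mul_Xgram // eqxx mulr1 mulrC.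
  under eq_bigr => j _ do rewrite mulrCA.
  have lk' : (val k == val l) = false by rewrite eq_sym; exact: negbTE lk.
  by rewrite -mulr_sumr gram_mul_Xgram // lk' !mulr0.
rewrite big1 // => j _; have := sumM _ (dnu_of_lin j).
rewrite big1 ?add0r => [H|l _]; last by rewrite dnu_of_U mulr0.
under eq_bigr => l _ do rewrite -dnu_of_X.
by rewrite H mulr0.
Qed.

(** Increasing triples of frame vectors are indexed by the missing one, as in
    the values computed above. *)
Lemma increasing3_bump i j k : (i < j)%N -> (j < k)%N -> (k < 4)%N ->
  exists2 r, (r < 4)%N & [/\ i = bump r 0, j = bump r 1 & k = bump r 2].
Proof.
move=> ij jk k4; have j4 := ltn_trans jk k4; have i4 := ltn_trans ij j4.
exists (6 - (i + j + k))%N; move: i j k ij jk i4 j4 k4;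
  by case=> [|[|[|[|i]]]] [|[|[|[|j]]]] [|[|[|[|k]]]].
Qed.

Lemma Phi_UUUX l m : (l < 4)%N ->
  Phi (U (bump l 0)) (U (bump l 1)) (U (bump l 2)) (Xvec m) = (-1) ^+ l * Xgram l m.
Proof.
by case: l => [|[|[|[|//]]]] _;
  rewrite /bump /= ?(Phi_U012, Phi_U013, Phi_U023, Phi_U123) dnu_of_X; ring.
Qed.

(** On an increasing tuple of the adapted frame the U's come before the X's,
    which leaves the five cases computed above. *)
Theorem Phi_eq_toric_form x y z w : Phi x y z w = toric_form (tnth [tuple x; y; z; w]).
Proof.
apply/eqP; rewrite -subr_eq0; apply/eqP.
pose F (v : 'I_4 -> E) := -1 * toric_form v +
  Phi (v (inord 0)) (v (inord 1)) (v (inord 2)) (v (inord 3)).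
have FP : alternating_form F.
  by apply: alternating_lin; [exact: alternating_toric_form|exact: alternating_form4].
transitivity (F (tnth [tuple x; y; z; w])).
  by rewrite /F mulN1r addrC !(tnth_nth x) /= !inordK.
apply: (alternating_eq0 (e := fun i : 'I_8 => adapted_frame i) FP adapted_frame_span)
  => f finc.
have h i j : (i < j)%N -> (j < 4)%N -> (f (inord i) < f (inord j))%N.
  by move=> ij j4; apply: finc; rewrite !inordK // (ltn_trans ij).
have h01 := h 0%N 1%N isT isT; have h12 := h 1%N 2 isT isT.
have h23 := h 2 3 isT isT.
rewrite /F [X in toric_form X]tuple4E /= mulN1r addrC.
have f8 := ltn_ord (f (inord 3)).
move: (val (f (inord 0))) (val (f (inord 1))) (val (f (inord 2))) (val (f (inord 3)))
  h01 h12 h23 f8.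
move=> i j k l ij jk kl l8; apply/eqP; rewrite subr_eq0; apply/eqP.
rewrite /adapted_frame; have [l4|l4] := ltnP l 4.
  have k4 := ltn_trans kl l4; have j4 := ltn_trans jk k4.
  by rewrite (ltn_trans ij j4) j4 k4 U_isotropic toric_form_UUUU.
have [k4|k4] := ltnP k 4.
  have j4 := ltn_trans jk k4; rewrite (ltn_trans ij j4) j4.
  have [r r4 [-> -> ->]] := increasing3_bump ij jk k4.
  by rewrite Phi_UUUX // toric_form_UUUX.
have [j4|j4] := ltnP j 4.
  have k8 : (k - 4 < 4)%N by rewrite ltn_subLR // (ltn_trans kl).
  have l8' : (l - 4 < 4)%N by rewrite ltn_subLR.
  by rewrite (ltn_trans ij j4) Phi_UUXX ?toric_form_UUXX ?(ltn_trans ij j4).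
have jk' : (j - 4 < k - 4)%N by rewrite ltn_sub2rE.
have kl' : (k - 4 < l - 4)%N by rewrite ltn_sub2rE.
have l8' : (l - 4 < 4)%N by rewrite ltn_subLR.
have [i4|i4] := ltnP i 4.
  have [r r4 [-> -> ->]] := increasing3_bump jk' kl' l8'.
  by rewrite Phi_UXXX // toric_form_UXXX.
have ij' : (i - 4 < j - 4)%N by rewrite ltn_sub2rE.
rewrite toric_form_XXXX.
have [r r4 [-> jr kr]] := increasing3_bump ij' jk' (ltn_trans kl' l8').
have r3 : r = 3.
  by move: kl' l8'; rewrite kr; case: r r4 {jr kr} => [|[|[|[|//]]]] _; case:
    (l - 4)%N => [|[|[|[|]]]].
have l3 : (l - 4)%N = 3.
  by apply/eqP; rewrite eqn_leq -ltnS l8'; move: kl'; rewrite kr r3.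
by rewrite jr kr l3 r3 Phi_XXXX.
Qed.

(** Both sides are symmetric bilinear, so they are compared on the adapted
    frame, where the two blocks are B and adj(B). *)
Theorem metric_eq_toric x y : g x y =
  Delta * (\sum_(i < 4) \sum_(j < 4) (Delta^-1 * gram i j)
    * sym_prod (theta i) (theta j) x y)
  + \sum_(i < 4) \sum_(j < 4) (Delta^-1 * gram i j) * sym_prod (dnu_of i) (dnu_of j) x y.
Proof.
have D0 := gram_det_neq0.
pose G (f : nat -> E -> R) x y := \sum_(i < 4) \sum_(j < 4)
   (Delta^-1 * gram i j) * (f i x * f j y).
have GC f u v : G f u v = G f v u.
  rewrite /G exchange_big; apply: eq_bigr => i _; apply: eq_bigr => j _.
  by rewrite gramC; ring.
have GE (f : nat -> E -> R) : \sum_(i < 4) \sum_(j < 4)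
    (Delta^-1 * gram i j) * sym_prod (f i) (f j) x y = G f x y.
  transitivity (2^-1 * (G f x y + G f y x)); last by rewrite (GC f y); field.
  rewrite /G -big_split mulr_sumr; apply: eq_bigr => i _ /=.
  rewrite -big_split mulr_sumr; apply: eq_bigr => j _ /=.
  by rewrite /sym_prod; field.
rewrite !GE; pose F x y := g x y + (-1) * (Delta * G theta x y + G dnu_of x y).
suff : F x y = 0 by rewrite /F mulN1r => /eqP; rewrite subr_eq0 => /eqP.
have FC u v : F u v = F v u by rewrite /F gC !(GC _ u).
have Glin f v : (forall i, scalar (f i)) -> scalar (fun u => G f u v).
  move=> fP r u u'; rewrite /G mulr_sumr -big_split; apply: eq_bigr => i _ /=.
  rewrite mulr_sumr -big_split; apply: eq_bigr => j _ /=; rewrite fP /=; ring.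
have Flin v : scalar (fun u => F u v).
  move=> r u u'; rewrite /F g_lin (Glin theta v theta_lin) (Glin dnu_of v dnu_of_lin)
    /=; ring.
suff F0 (i j : 'I_8) : F (adapted_frame i) (adapted_frame j) = 0.
  have [c ->] := adapted_frame_span x; rewrite (scalar_sum (Flin _)) big1 // => i _.
  rewrite FC; have [c' ->] := adapted_frame_span y;
    rewrite (scalar_sum (Flin _)) big1 ?mulr0 // => j _.
  by rewrite FC F0 mulr0.
have G0l f u v : (forall i, f i u = 0) -> G f u v = 0.
  by move=> f0; rewrite /G big1 // => k _; rewrite big1 // => l _; rewrite f0 mul0r mulr0.
have sub4 (k : 'I_8) : (4 <= k)%N -> (k - 4 < 4)%N by move=> k4; rewrite ltn_subLR.
have FUX a m : F (U a) (Xvec m) = 0.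
  rewrite /F gC g_Xvec_U (G0l dnu_of) => [|k]; last exact: dnu_of_U.
  rewrite GC (G0l theta) => [|k]; last exact: theta_Xvec.
  by ring.
have sumd a (F' : nat -> R) : (a < 4)%N ->
    \sum_(i < 4) (i == a :> nat)%:R * F' i = F' a.
  move=> a4; rewrite (bigD1 (Ordinal a4)) //= eqxx mul1r big1 ?addr0 // => k ka.
  have ka' : (val k == a) = false by exact: negbTE ka.
  by rewrite ka' mul0r.
have FUU a m : (a < 4)%N -> (m < 4)%N -> F (U a) (U m) = 0.
  move=> a4 m4; rewrite /F (G0l dnu_of) => [|k]; last exact: dnu_of_U.
  suff -> : G theta (U a) (U m) = Delta^-1 * gram a m by rewrite -/(gram a m); field.
  rewrite /G -(sumd a (fun i => Delta^-1 * gram i m)) //; apply: eq_bigr => k _.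
  rewrite -(sumd m (fun j => Delta^-1 * gram k j)) // mulr_sumr.
  by apply: eq_bigr => l _; rewrite !thetaU //; ring.
have FXX a m : (a < 4)%N -> (m < 4)%N -> F (Xvec a) (Xvec m) = 0.
  move=> a4 m4; rewrite /F (G0l theta) => [|k]; last exact: theta_Xvec.
  suff -> : G dnu_of (Xvec a) (Xvec m) = Xgram a m by rewrite /Xgram; ring.
  rewrite /G exchange_big /= -(sumd a (fun j => Xgram j m)) //.
  apply: eq_bigr => l _; apply: (mulfI D0);
    rewrite [RHS]mulrA -gram_mul_Xgram // [RHS]mulr_suml.
  by rewrite [LHS]mulr_sumr; apply: eq_bigr => k _; rewrite !dnu_of_X (gramC k l); field.
rewrite /adapted_frame; have [i4|/sub4 i4] := ltnP i 4; have [j4|/sub4 j4] := ltnP j 4.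
- exact: FUU.
- exact: FUX.
- by rewrite FC FUX.
- exact: FXX.
Qed.

End Toric.

(** * Torus actions and multi-moment maps *)

Section TorusInvariance.
Variables (R : realType) (M : manifold R 8).
Variables (Phi : M -> kform R 'rV[R]_8 4) (act : 'rV[R]_4 -> M -> M).
Hypothesis actP : torus_action act.
Variable nu : M -> kform R 'rV[R]_4 3.
Hypothesis nuP : multi_moment_map Phi act nu.

Lemma differentiable_chart_orbit (p : M) :
  differentiable (fun s : 'rV[R]_4 => cmap (chart_at M p) (act s p)) 0.
Proof.
set c := chart_at M p; have cp : cdom c p by exact: chart_at_dom.
have cK : cinv c (cmap c p) = p by exact: cmapK.
pose F (z : 'rV[R]_4 * 'rV[R]_8) := cmap c (act z.1 (cinv c z.2)).
rewrite (_ : (fun s => _) = F \o (fun s => (s, cmap c p))); last first.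
  by apply/funext => s; rewrite /F /= cK.
apply: differentiable_comp.
  by apply: differentiable_pair; [exact: ex_diff|exact: differentiable_cst].
have [+ _] := act_smooth actP (chart_at_atlas p) (chart_at_atlas p) 1.
apply; split => /=; first by exists p.
by rewrite cK (act_0 actP).
Qed.

Lemma near_orbit_chart (p : M) :
  \forall s \near (0 : 'rV[R]_4), cdom (chart_at M p) (act s p).
Proof.
set c := chart_at M p; have cp : cdom c p by exact: chart_at_dom.
have pairc : (s, p) @[s --> (0 : 'rV[R]_4)] --> ((0 : 'rV[R]_4), p).
  move=> A [[B C] /= [nB nC] BC]; apply: filterS nB => s Bs.
  by apply: BC; split => //=; exact: nbhs_singleton nC.
have cts : act s p @[s --> (0 : 'rV[R]_4)] --> act 0 p.
  have ac : continuous (fun z : 'rV[R]_4 * M => act z.1 z.2) := act_cont actP.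
  by move=> A /(ac (0, p)) /pairc.
apply: cts; apply: open_nbhs_nbhs; split; first exact: cdom_open.
by rewrite (act_0 actP).
Qed.

Lemma differentiable_moment (w : 'I_3 -> 'rV[R]_4) (p : M) :
  differentiable ((fun q => nu q w) \o cinv (chart_at M p)) (Defs.cpoint p).
Proof.
have sm : smooth_fun (fun q => nu q w) := mmm_smooth nuP w.
have [+ _] := sm _ (chart_at_atlas p) 1%N.
by apply; exists p => //; exact: chart_at_dom.
Qed.

(** The moment map is constant along the orbit s |-> act s p, so by the chain
    rule its differential kills the generator xi(e); that differential is
    Phi(xi(a), xi(b), xi(c), .). *)
Lemma torus_isotropic (p : M) (a b c e : 'rV[R]_4) :
  Phi p (tnth [tuple xi act a p; xi act b p; xi act c p; xi act e p]) = 0.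
Proof.
pose w : 'I_3 -> 'rV[R]_4 := tnth [tuple a; b; c].
have := mmm_diff nuP w p (xi act e p).
rewrite /w !(tnth_nth 0) /= !inordK //= => <-.
pose gam (s : 'rV[R]_4) := cmap (chart_at M p) (act s p).
pose h := (fun q => nu q w) \o cinv (chart_at M p).
have dg : differentiable gam 0 := differentiable_chart_orbit p.
have g0E : gam 0 = Defs.cpoint p by rewrite /gam (act_0 actP).
have dh : differentiable h (gam 0) by rewrite g0E; exact: differentiable_moment.
rewrite /fdiff -/h /xi -/gam deriveE // -g0E.
rewrite -[LHS]/(('d h (gam 0) \o 'd gam 0) e) -diff_comp //.
rewrite -deriveE; last exact: differentiable_comp.
rewrite (@near_eq_derive _ _ _ _ (cst (nu p w))) ?derive_cst //.
near=> s; rewrite /h /gam /= cmapK; last by near: s; exact: near_orbit_chart.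
by rewrite (mmm_inv nuP).
Unshelve. all: by end_near.
Qed.

Lemma fdiff_nu_comp (u : 'M[R]_4) (i : 'I_4) p X :
  fdiff (nu_comp nu u i) p X = (-1) ^+ i * Phi p (tnth
    [tuple xi act (row (ordS i) u) p; xi act (row (ordS (ordS i)) u) p;
           xi act (row (ordS (ordS (ordS i))) u) p; X]).
Proof.
pose w := tnth [tuple row (ordS i) u; row (ordS (ordS i)) u;
  row (ordS (ordS (ordS i))) u].
have := mmm_diff nuP w p X.
rewrite /w !(tnth_nth 0) /= !inordK //= => <-; rewrite -/w /fdiff.
rewrite (_ : nu_comp nu u i \o _ = (-1) ^+ i *:
  ((fun q => nu q w) \o cinv (chart_at M p)));
  last by apply/funext.
by rewrite diffZ //; exact: differentiable_moment.
Qed.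

End TorusInvariance.

(** * The theorem *)

Section Frame.
Variable R : realType.
Local Notation E := 'rV[R]_8.

Definition cross0 (x y z : E) : E := \row_l Phi4 x y z (Evec l).

Lemma g0_cross0 x y z w : g0 (cross0 x y z) w = Phi4 x y z w.
Proof.
rewrite {2}[w]row_sum_delta; under eq_bigr => i _ do rewrite -{2}[i]inord_val.
rewrite (scalar_sum (Phi4lin4 x y z) (fun i => w 0 i) (fun i : 'I_8 => Evec i)).
by apply: eq_bigr => i _; rewrite !mxE mulrC.
Qed.

Lemma cross0_identity x y z a b c :
  g0 (cross0 x y z) (cross0 a b c) = cross_gram Phi4 (@g0 R) x y z a b c.
Proof.
have <- : foldr (fun l acc => Phi4 x y z (Evec l) * Phi4 a b c (Evec l) + acc)
    0 (iota 0 8) = g0 (cross0 x y z) (cross0 a b c).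
  rewrite /g0; under eq_bigr => l _ do rewrite !mxE.
  by rewrite !big_ord_recl big_ord0.
by apply/eqP; rewrite -subr_eq0; apply/eqP; exact: cross_identity.
Qed.

End Frame.

Theorem proposition3p2 (R : realType) (M : manifold R 8)
    (Phi : M -> kform R 'rV[R]_8 4) (g : M -> 'rV[R]_8 -> 'rV[R]_8 -> R)
    (act : 'rV[R]_4 -> M -> M) (toric : toric_Spin7 Phi g act)
    (nu : M -> kform R 'rV[R]_4 3) (nuP : multi_moment_map Phi act nu)
    (u : 'M[R]_4) (u_basis : u \in unitmx)
    (theta : 'I_4 -> M -> 'rV[R]_8 -> R)
    (thetaP : dual_one_forms g (torus_generator act u) (principal act) theta)
    (p : M) (M0p : principal act p) :
  let V : 'M[R]_4 := invmx (gramB g (torus_generator act u) p) in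
  let th (i : 'I_4) : 'rV[R]_8 -> R := theta i p in
  let dnu (i : 'I_4) : 'rV[R]_8 -> R := fdiff (nu_comp nu u i) p in
  let dnu_adjV_th : kform R 'rV[R]_8 2 :=
    fun v => \sum_i \sum_j (\adj V) i j * wedge_list [tuple dnu i; th j] v in
  (forall v : 'I_4 -> 'rV[R]_8,
     Phi p v =
       \det V * (\sum_(i < 4)
         let j := ordS i in let k := ordS j in let l := ordS k in
         (-1) ^+ i * wedge_list [tuple th i; dnu j; dnu k; dnu l] v)
       + (\sum_(i < 4)
         let j := ordS i in let k := ordS j in let l := ordS k in
         (-1) ^+ l * wedge_list [tuple th i; th j; th k; dnu l] v)
       + (2 * \det V)^-1 * wedge_form dnu_adjV_th dnu_adjV_th v)
  /\
  (forall X Y : 'rV[R]_8,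
     g p X Y =
       (\det V)^-1 * (\sum_i \sum_j (\adj V) i j * sym_prod (th i) (th j) X Y)
       + \sum_i \sum_j (\adj V) i j * sym_prod (dnu i) (dnu j) X Y).
Proof.
move=> V th dnu om.
have PhiP : alternating_form (Phi p).
  by have [[Phi_alt _] _] := toric_Spin7_structure toric; exact: Phi_alt.
have [gR /(_ p)[F [Fu FPhi] Fg]] := toric_metric toric.
pose ph x y z w := Phi p (tnth [tuple x; y; z; w]).
(* The cross product of the standard model, carried to the tangent space by the
   frame. *)
pose P x y z := cross0 (x *m invmx F) (y *m invmx F) (z *m invmx F) *m F.
have phF x y z w : ph x y z w
    = Phi4 (x *m invmx F) (y *m invmx F) (z *m invmx F) (w *m invmx F).
  rewrite /ph /Phi4 -FPhi; congr (Phi p _); apply/funext => i.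
  by rewrite !(tnth_nth 0); case: i => [[|[|[|[|//]]]] i4] /=; rewrite mulmxKV.
have gF x y : g p x y = g0 (x *m invmx F) (y *m invmx F).
  by rewrite -Fg !mulmxKV.
have phP x y z w : ph x y z w = g p (P x y z) w.
  by rewrite phF gF /P mulmxK // g0_cross0.
have crossP x y z a b c := cross0_identity (x *m invmx F) (y *m invmx F)
  (z *m invmx F) (a *m invmx F) (b *m invmx F) (c *m invmx F).
pose U k := torus_generator act u (inord k) p.
pose t k := theta (inord k) p.
have Uiso a b c e : ph (U a) (U b) (U c) (U e) = 0.
  exact: (torus_isotropic (toric_action toric) nuP).
have tlin i : scalar (t i) by have [] := thetaP p M0p (inord i).
have tU i j : (i < 4)%N -> (j < 4)%N -> t i (U j) = (i == j)%:R.
  move=> i4 j4; rewrite /t /U; have [_ -> _] := thetaP p M0p (inord i).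
  by rewrite -val_eqE /= !inordK.
have tperp i x : (forall j, (j < 4)%N -> g p x (U j) = 0) -> t i x = 0.
  move=> xU; have [_ _] := thetaP p M0p (inord i); apply => j.
  by rewrite -[j]inord_val; exact: xU.
have crossP' x y z a b c :
    g p (P x y z) (P a b c) = cross_gram ph (g p) x y z a b c.
  by rewrite gF /P !mulmxK // crossP /cross_gram -!gF -!phF.
have hyps := Phi_eq_toric_form (curry4lin PhiP) (curry4C12 PhiP) (curry4C23 PhiP)
  (curry4C34 PhiP) (riem_lin gR p) (riem_sym gR p) (@riem_pos _ _ _ _ gR p) phP
  crossP' Uiso tlin tU tperp.
have hypg := metric_eq_toric (curry4lin PhiP) (curry4C12 PhiP) (curry4C23 PhiP)
  (curry4C34 PhiP) (riem_lin gR p) (riem_sym gR p) (@riem_pos _ _ _ _ gR p) phP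
  crossP' Uiso tlin tU tperp.
have Bu : gram_mx (g p) U \in unitmx := gram_unit (riem_lin gR p) (riem_sym gR p)
  (@riem_pos _ _ _ _ gR p) tlin tU tperp.
have BE : gramB g (torus_generator act u) p = gram_mx (g p) U.
  by apply/matrixP => i j; rewrite !mxE /gram /U !inord_val.
have dV : \det V = (\det (gram_mx (g p) U))^-1 by rewrite /V BE det_inv.
have D0 : \det (gram_mx (g p) U) != 0 by rewrite -unitfE -unitmxE.
(* V is the inverse of B, so adj(V) = det(V) V^-1 = det(B)^-1 B. *)
have adjV i j : (\adj V) i j = (\det (gram_mx (g p) U))^-1 * gram (g p) U i j.
  have Vu : V \in unitmx by rewrite /V BE unitmx_inv.
  have : invmx V = gram_mx (g p) U by rewrite /V BE invmxK.
  rewrite {1}/invmx Vu => /(congr1 ( *:%R (\det V))).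
  rewrite scalerA divff ?scale1r ?dV ?invr_neq0 // => ->.
  by rewrite !mxE.
have thE i : th i = t i by rewrite /t inord_val.
have dnuE (i : 'I_4) : dnu i = dnu_of ph U i.
  apply/funext => X; rewrite /dnu (fdiff_nu_comp nuP) /dnu_of /ph /U.
  rewrite (_ : inord _ = ordS i); last by apply: val_inj; rewrite /= inordK // ltn_mod.
  rewrite (_ : inord _ = ordS (ordS i)); last by apply: val_inj;
    rewrite /= inordK // ltn_mod.
  by rewrite (_ : inord _ = ordS (ordS (ordS i))); last by apply: val_inj;
    rewrite /= inordK // ltn_mod.
have omE : om = omega ph (g p) U t.
  apply/funext => v; apply: eq_bigr => i _; apply: eq_bigr => j _.
  by rewrite adjV dnuE thE.
split=> [v|X Y].
  rewrite [v]tuple4E [LHS]hyps /toric_form dV omE.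
  congr (_ * _ + _ + _); apply: eq_bigr => i _ /=; by rewrite !dnuE !thE.
rewrite hypg dV invrK.
congr (_ * _ + _); apply: eq_bigr => i _; apply: eq_bigr => j _;
  by rewrite adjV ?dnuE ?thE.
Qed.
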